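(* Consider the WZW $\sigma$-model on a worldsheet $\Sigma$ with a non-empty boundary-type defect $\Sigma^{(1)}=\partial\Sigma$, $\partial\Sigma^{(1)}=\emptyset$ (without junctions), mapped into the worldvolume $Q_\partial=\bigsqcup_{\lambda\in P^{\mathsf k}_+(\mathfrak g)}\mathscr C_\lambda$ of the maximally symmetric WZW D-brane of curvature $\omega^{(\mathsf k)}_\partial$, where $\omega_\partial^{(\mathsf k)}$ is assumed invariant under the adjoint action $\ell\wp^\partial_x(g)=xgx^{-1}$ of $\mathrm G$ on $Q_\partial$. The following two properties: (a) the sets $\mathcal F(\Sigma,d;\eta)$ and $\mathcal F_{\rm eom}(\Sigma,d;\eta)$ admit a left action of the loop group $\mathsf L\mathrm G$ of the form $$\mathsf L\mathrm G\times\mathcal F_{({\rm eom})}(\Sigma,d;\eta)\to\mathcal F_{({\rm eom})}(\Sigma,d;\eta),\qquad (h,g)\mapsto h^+\cdot g\cdot(h^-)^{-1};$$ (b) the chiral currents of the bulk Kač–Moody symmetry glue at the boundary as $(J_R-J_L)|_{\partial\Sigma}=0$, hold if and only if the curvature restricts to the connected components of $Q_\partial$ as $$\omega_{\partial}^{(\mathsf k)}\big|_{\mathscr C_\lambda}=\tfrac{\mathsf k}{8\pi}\,\mathrm{tr}_{\mathfrak g}\Big(\theta_{\rm L}\wedge\Big(\tfrac{\mathrm{id}_{\mathfrak g}+\mathsf T_e\mathrm{Ad}_\cdot}{\mathrm{id}_{\mathfrak g}-\mathsf T_e\mathrm{Ad}_\cdot}\Big)\circ\theta_{\rm L}\Bi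g).$$
   Context: $\mathrm G$ is a compact simple 1-connected Lie group, $\mathfrak g$ its Lie algebra with generators $t_A$, $\mathrm{tr}_{\mathfrak g}(t_At_B)=-\tfrac12\delta_{AB}$, level $\mathsf k\in\mathbb N^\times$; $\theta_{\rm L}$ is the left-invariant Maurer–Cartan form; $\mathrm{Ad}_x(g)=xgx^{-1}$. The bulk target is $\mathrm G$ with metric $\mathrm g=-\tfrac{\mathsf k}{4\pi}\mathrm{tr}_{\mathfrak g}(\theta_{\rm L}\otimes\theta_{\rm L})$ and 3-form $\mathrm H=\tfrac{\mathsf k}{12\pi}\mathrm{tr}_{\mathfrak g}(\theta_{\rm L}\wedge\theta_{\rm L}\wedge\theta_{\rm L})$. $P_+^{\mathsf k}(\mathfrak g)=\mathsf k\mathscr A_{\rm W}(\mathfrak g)\cap P(\mathfrak g)$ is the set of weights in the $\mathsf k$-rescaled Weyl alcove $\mathscr A_{\rm W}(\mathfrak g)=\{\lambda\in\mathfrak t:\langle\lambda,\theta\rangle\le1,\langle\lambda,\alpha_i\rangle\ge0\}$; $\mathscr C_\lambda=\{\mathrm{Ad}_x(e^{2\pi i\lambda/\mathsf k})\}_{x\in\mathrm G}$. A D-brane curvature is a 2-form $\omega^{(\mathsf k)}_\partial$ on $Q_\partial$ with $\mathrm d\omega_\partial^{(\mathsf k)}=\mathrm H|_{Q_\partial}$. The worldsheet has coordinates $(\sigma^1,\sigma^2)$, $\sigma^2$ periodic, Minkowskian metric $\eta=-d\sigma^1\otimes d\sigma^1+d\sigma^2\otimes d\sigma^2$, light-cone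 coordinates $\sigma^\pm=\sigma^2\pm\sigma^1$ with derivatives $\partial_\pm=\partial/\partial\sigma^\pm$, and (boundary) defect circle $\{\sigma^1=0\}$ with tangent $t=\partial_2$. $\mathcal F(\Sigma,d;\eta)$ is the set of smooth $g:\Sigma\to\mathrm G$ with $g(\partial\Sigma)\subset Q_\partial$ satisfying the Defect Gluing Condition at the boundary: $-\mathrm g_{g(p)}(V,g_*(\partial_1))=\omega^{(\mathsf k)}_{\partial}(V,g_*(\partial_2))$ for all $p\in\partial\Sigma$ and all $V\in\mathsf T_{g(p)}Q_\partial$. $\mathcal F_{\rm eom}(\Sigma,d;\eta)$ is the subset of those obeying the field equation $\partial_+(g^{-1}\partial_-g)=0$. $\mathsf L\mathrm G=C^\infty(S^1,\mathrm G)$, $h^\pm(\sigma)=h(\sigma^\pm)$. The chiral currents are $J_L=\tfrac{\mathsf k}{2\pi}g\,\partial_+g^{-1}$ and $J_R=\tfrac{\mathsf k}{2\pi}g^{-1}\partial_-g$. *)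

(* Defs.v *)
(* MathComp / MathComp-Analysis *)
From HB Require Import structures.
From mathcomp Require Import all_boot all_order all_algebra.
From mathcomp Require Import all_classical all_reals all_analysis.

Set Implicit Arguments.
Unset Strict Implicit.
Unset Printing Implicit Defensive.

Import Order.TTheory GRing.Theory Num.Theory.
Import numFieldNormedType.Exports.

Local Open Scope classical_set_scope.
Local Open Scope ring_scope.

(* C^(k+1) means: differentiable, with tangent map (x, v) |-> df_x(v) of
   class C^k.  In finite dimension this is the usual notion. *)
Fixpoint Ck_on (R : realType) (k : nat) :
    forall V W : normedModType R, set V -> (V -> W) -> Prop :=
  match k with
  | 0 => fun V W U f => forall x, U x -> {for x, continuous f}
  | k'.+1 => fun V W U f =>
      (forall x, U x -> differentiable f x) /\
      @Ck_on R k' _ W (U `*` setT) (fun p : V * V => 'd f (p.1) p.2)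
  end.

Definition smooth_on (R : realType) (V W : normedModType R) (U : set V)
  (f : V -> W) := forall k, Ck_on k U f.

(* Derivative of [f] at [p] along [v] using only points of [S]; it is one-sided
   at a boundary point of [S] if [v] is transverse to the boundary. *)
Definition deriv_in (R : realType) (V W : normedModType R) (S : set V)
    (f : V -> W) (p v : V) : W :=
  lim ((fun h : R => h^-1 *: (f (p + h *: v) - f p)) @
       within [set h : R | S (p + h *: v)] (0 : R)^').

(* A smooth structure is given by an atlas indexed by the points, [chart p]
   being a chart around [p]; [chart_inv p] is its inverse parametrisation. *)
HB.mixin Record isManifold (R : realType) (n : nat) M of Topological M := {
  chart_dom : M -> set M;
  chart : M -> M -> 'rV[R]_n;
  chart_inv : M -> 'rV[R]_n -> M;
  manifold_hausdorff : hausdorff_space M;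
  manifold_second_countable : @second_countable M;
  chart_dom_open : forall p, open (chart_dom p);
  chart_dom_self : forall p, chart_dom p p;
  chart_img_open : forall p, open (chart p @` chart_dom p);
  chartK : forall p q, chart_dom p q -> chart_inv p (chart p q) = q;
  chart_continuous :
    forall p q, chart_dom p q -> {for q, continuous (chart p)};
  chart_inv_continuous :
    forall p u, (chart p @` chart_dom p) u -> {for u, continuous (chart_inv p)};
  chart_transition : forall p q,
    smooth_on (chart p @` (chart_dom p `&` chart_dom q))
              (chart q \o chart_inv p)
}.

#[short(type="manifoldType")]
HB.structure Definition Manifold (R : realType) (n : nat) :=
  {M of Topological M & isManifold R n M}.

Definition chart_img (R : realType) (n : nat) (M : manifoldType R n) (p : M) :
  set 'rV[R]_n := chart p @` chart_dom p.

(* Smooth maps from a subset [S] of a normed space (an open set, or a domain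
   with boundary) to a manifold: in a chart, [f] extends locally to a smooth
   map. *)
Definition smooth_to (R : realType) (V : normedModType R) (n : nat)
    (M : manifoldType R n) (S : set V) (f : V -> M) : Prop :=
  {within S, continuous f} /\
  forall x, S x -> exists (U : set V) (F : V -> 'rV[R]_n),
    [/\ open U, U x, smooth_on U F &
        forall y, S y -> U y -> F y = chart (f x) (f y)].

(* The tangent space T_p M is 'rV[R]_n, through the chart [chart p]. *)

Definition velocity (R : realType) (V : normedModType R) (n : nat)
    (M : manifoldType R n) (S : set V) (F : V -> M) (u v : V) : 'rV[R]_n :=
  deriv_in S (chart (F u) \o F) u v.

Definition tangent_map (R : realType) (V : normedModType R) (n : nat)
    (M : manifoldType R n) (F : V -> M) (u v : V) : 'rV[R]_n :=
  'd (chart (F u) \o F) u v.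

Definition mdiff (R : realType) (m n : nat) (M : manifoldType R m)
    (N : manifoldType R n) (f : M -> N) (p : M) (v : 'rV[R]_m) : 'rV[R]_n :=
  tangent_map (f \o chart_inv p) (chart p p) v.

HB.mixin Record isLieGroup (R : realType) (n : nat) G
    of Group G & Manifold R n G := {
  lie_mul_smooth : forall a b : G,
    smooth_to (chart_img a `*` chart_img b)
      (fun u : 'rV[R]_n * 'rV[R]_n =>
         (chart_inv a u.1 * chart_inv b u.2)%g : G);
  lie_inv_smooth : forall a : G,
    smooth_to (chart_img a) (fun u : 'rV[R]_n => ((chart_inv a u)^-1)%g : G)
}.

#[short(type="lieGroupType")]
HB.structure Definition LieGroup (R : realType) (n : nat) :=
  {G of Group G & Manifold R n G & isLieGroup R n G}.

Section LieGroupTheory.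
Variables (R : realType) (n : nat) (G : lieGroupType R n).
Implicit Types (x q : G) (X Y Z V W : 'rV[R]_n).

Definition simply_connected : Prop :=
  forall c : R -> G, {within `[0, 1], continuous c} -> c 0 = c 1 ->
  exists H : R * R -> G,
    [/\ {within `[0, 1] `*` `[0, 1], continuous H},
        forall t, t \in `[0, 1] -> H (0, t) = c t,
        forall t, t \in `[0, 1] -> H (1, t) = c 0 &
        forall s, s \in `[0, 1] -> H (s, 0) = c 0 /\ H (s, 1) = c 0].

Definition one_connected : Prop := connected [set: G] /\ simply_connected.

(* The Lie algebra of G is T_1 G, i.e. 'rV[R]_n through the chart [chart 1]. *)

Definition theta_L x V : 'rV[R]_n := mdiff (fun y : G => (x^-1 * y)%g) x V.

Definition Ad x X : 'rV[R]_n := mdiff (fun y : G => (x * y * x^-1)%g) 1%g X.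

(* [X, Y] is the derivative at 1, along X, of x |-> Ad_x(Y). *)
Definition bracket X Y : 'rV[R]_n :=
  'd (fun u : 'rV[R]_n => Ad (chart_inv 1%g u) Y) (chart (1%g : G) 1%g) X.

(* [A] stands for its row space, an arbitrary linear subspace. *)
Definition is_ideal (A : 'M[R]_n) : Prop :=
  forall X Y, (Y <= A)%MS -> (bracket X Y <= A)%MS.

Definition simple_lie_algebra : Prop :=
  (exists X Y, bracket X Y != 0) /\
  forall A : 'M[R]_n, is_ideal A -> \rank A = 0%N \/ \rank A = n.

(* q = exp(X): q = c(1) for the one-parameter subgroup c with c'(0) = X. *)
Definition is_exp X q : Prop :=
  exists c : R -> G,
    [/\ smooth_to setT c, forall s t, c (s + t) = (c s * c t)%g,
        velocity setT c 0 1 = X & c 1 = q].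

(* An Ad-invariant form with tr(t_A t_B) = - delta_AB / 2, the rows of [t]
   being the generators t_A.  Its scale is left to the choice of the t_A. *)
Definition trace_form (tr : 'rV[R]_n -> 'rV[R]_n -> R) (t : 'M[R]_n) : Prop :=
  [/\ forall a X Y Z, tr (a *: X + Y) Z = a * tr X Z + tr Y Z,
      forall X Y, tr X Y = tr Y X,
      forall x X Y, tr (Ad x X) (Ad x Y) = tr X Y,
      t \in unitmx &
      forall i j, tr (row i t) (row j t) = - 2^-1 * (i == j)%:R].

Definition cartan (T : 'M[R]_n) : Prop :=
  (forall X Y, (X <= T)%MS -> (Y <= T)%MS -> bracket X Y = 0) /\
  (forall X, (forall Y, (Y <= T)%MS -> bracket X Y = 0) -> (X <= T)%MS).

Section Roots.
Variables (tr : 'rV[R]_n -> 'rV[R]_n -> R) (T : 'M[R]_n).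

(* Weights are usually taken Hermitian, so that exp(2 pi i lambda / k) is in G;
   here lambda is represented by i lambda, which lies in the real Lie algebra of
   G (of anti-Hermitian elements).  The dual of the Cartan algebra T is
   identified with T by this inner product, so that <a, lambda> is the value of
   the root a on lambda. *)
Definition ip X Y : R := - tr X Y.

(* [E = X - iY] is a root vector of the complexified Lie algebra:
   [[i lambda, E] = i <a, lambda> E]. *)
Definition is_root (a : 'rV[R]_n) : Prop :=
  [/\ (a <= T)%MS, a != 0 &
      exists X Y, ((X != 0) || (Y != 0)) /\
        forall L, (L <= T)%MS ->
          bracket L X = ip a L *: Y /\ bracket L Y = - ip a L *: X].

(* The rows of [S] are the simple roots alpha_i. *)
Definition nat_comb (r : nat) (S : 'M[R]_(r, n)) (v : 'rV[R]_n) : Prop :=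
  exists m : 'I_r -> nat, v = \sum_(i < r) (m i)%:R *: row i S.

Definition simple_roots (r : nat) (S : 'M[R]_(r, n)) : Prop :=
  [/\ forall i, is_root (row i S), row_free S &
      forall a, is_root a -> nat_comb S a \/ nat_comb S (- a)].

Definition highest_root (r : nat) (S : 'M[R]_(r, n)) (theta : 'rV[R]_n) :
  Prop := is_root theta /\ forall a, is_root a -> nat_comb S (theta - a).

Definition weyl_alcove (r : nat) (S : 'M[R]_(r, n)) (theta : 'rV[R]_n) :
    set 'rV[R]_n :=
  [set L | [/\ (L <= T)%MS, ip L theta <= 1 & forall i, 0 <= ip L (row i S)]].

(* A weight mu is viewed in the Cartan algebra through the multiple (.,.) of
   [ip] with (theta, theta) = 2: if mu = (L, .), its value on the coroot of
   [a] is 2 <L, a> / (a, a), which is the number below. *)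
Definition weight_lattice (theta : 'rV[R]_n) : set 'rV[R]_n :=
  [set L | (L <= T)%MS /\
     forall a, is_root a -> ip L a * (ip theta theta / ip a a) \is a Num.int].

Definition dominant_weights (k : nat) (r : nat) (S : 'M[R]_(r, n))
    (theta : 'rV[R]_n) : set 'rV[R]_n :=
  [set k%:R *: L | L in weyl_alcove S theta] `&` weight_lattice theta.

Definition conj_class (k : nat) (L : 'rV[R]_n) : set G :=
  [set g | exists q x, is_exp ((2 * pi / k%:R) *: L) q /\
                       g = (x * q * x^-1)%g].

Definition brane (k : nat) (r : nat) (S : 'M[R]_(r, n)) (theta : 'rV[R]_n) :
    set G :=
  \bigcup_(L in dominant_weights k S theta) conj_class k L.

End Roots.

(* Tangent space at [q] of the conjugacy class of [q], i.e. the image of the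
   differential of the orbit map. *)
Definition tangent_class q : set 'rV[R]_n :=
  range (mdiff (fun x : G => (x * q * x^-1)%g) 1%g).

Section Background.
Variables (tr : 'rV[R]_n -> 'rV[R]_n -> R) (k : nat).

Definition metric x V W : R :=
  - (k%:R / (4 * pi)) * tr (theta_L x V) (theta_L x W).

(* For products of Lie-algebra valued 1-forms, evaluated with the convention
   (a /\ b)(V, W) = a(V) b(W) - a(W) b(V), one has
   tr(theta /\ theta /\ theta)(U, V, W)
     = 3 tr(theta(U) [theta(V), theta(W)]). *)
Definition H3 x U V W : R :=
  k%:R / (12 * pi) *
  (3 * tr (theta_L x U) (bracket (theta_L x V) (theta_L x W))).

Definition Ad_mx x : 'M[R]_n := lin1_mx (Ad x).

(* The operator (id + Ad_x) / (id - Ad_x), defined on the image of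
   id - Ad_x; the choice of preimage made by [pinvmx] is immaterial in
   [standard_curvature], as ker (id - Ad_x) is orthogonal to that image. *)
Definition cayley_Ad x X : 'rV[R]_n :=
  X *m pinvmx (1%:M - Ad_mx x) *m (1%:M + Ad_mx x).

Definition standard_curvature x V W : R :=
  k%:R / (8 * pi) *
  (tr (theta_L x V) (cayley_Ad x (theta_L x W))
   - tr (theta_L x W) (cayley_Ad x (theta_L x V))).

Section TwoForms.
Variables (Q : set G) (om : G -> 'rV[R]_n -> 'rV[R]_n -> R).

Definition pullback2 (F : 'rV[R]_n -> G) (u v w : 'rV[R]_n) : R :=
  om (F u) (tangent_map F u v) (tangent_map F u w).

Definition ext_deriv2 (al : 'rV[R]_n -> 'rV[R]_n -> 'rV[R]_n -> R)
    (u v1 v2 v3 : 'rV[R]_n) : R :=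
  'D_v1 (fun y => al y v2 v3 : R^o) u - 'D_v2 (fun y => al y v1 v3 : R^o) u
  + 'D_v3 (fun y => al y v1 v2 : R^o) u.

(* The submersion x |-> x q x^-1 onto the class of [q], in the chart at [p]. *)
Definition orbit_param q (p : G) : 'rV[R]_n -> G :=
  fun u => (chart_inv p u * q * (chart_inv p u)^-1)%g.

(* [om x] is only relevant on tangent vectors to [Q].  Since the orbit maps are
   surjective submersions onto the components of [Q], smoothness and the
   exterior derivative are those of the pullbacks along these maps. *)
Definition two_form : Prop :=
  [/\ forall q, Q q -> forall a V V' W, tangent_class q V ->
        tangent_class q V' -> tangent_class q W ->
        om q (a *: V + V') W = a * om q V W + om q V' W,
      forall q, Q q -> forall V, tangent_class q V -> om q V V = 0 &
      forall q, Q q -> forall (p : G) v w,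
        smooth_on (chart_img p)
          (fun u => pullback2 (orbit_param q p) u v w : R^o)].

Definition brane_curvature : Prop :=
  two_form /\
  forall q, Q q -> forall (p : G) (u v1 v2 v3 : 'rV[R]_n), chart_img p u ->
    let F := orbit_param q p in
    ext_deriv2 (pullback2 F) u v1 v2 v3 =
    H3 (F u) (tangent_map F u v1) (tangent_map F u v2) (tangent_map F u v3).

Definition Ad_invariant : Prop :=
  forall x q, Q q -> forall V W, tangent_class q V -> tangent_class q W ->
    om (x * q * x^-1)%g (mdiff (fun y : G => (x * y * x^-1)%g) q V)
                        (mdiff (fun y : G => (x * y * x^-1)%g) q W)
    = om q V W.

(* Functions of the periodic coordinate sigma^2 are 2 pi-periodic functions on
   R; the worldsheet is the half-cylinder on either side ([left] or not) of the
   defect circle sigma^1 = 0.  Values of [g] off the worldsheet are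
   irrelevant. *)
Definition worldsheet (left : bool) : set (R * R) :=
  [set p | if left then p.1 <= 0 else 0 <= p.1].

Definition d1 : R * R := (1, 0).
Definition d2 : R * R := (0, 1).
(* sigma^(+-) = sigma^2 +- sigma^1, hence d_(+-) = (d_2 +- d_1) / 2 *)
Definition dplus : R * R := 2^-1 *: (d2 + d1).
Definition dminus : R * R := 2^-1 *: (d2 - d1).

Section Fields.
Variable left : bool.

(* g^-1 d_v g *)
Definition log_deriv (g : R * R -> G) (p v : R * R) : 'rV[R]_n :=
  theta_L (g p) (velocity (worldsheet left) g p v).

(* The tangency clause says that g_*(d_2), which enters [om], is tangent to
   [Q]; this holds because g maps the boundary to the submanifold [Q]. *)
Definition gluing_condition (g : R * R -> G) : Prop :=
  forall s : R, let p := (0, s) in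
    tangent_class (g p) (velocity (worldsheet left) g p d2) /\
    forall V, tangent_class (g p) V ->
      - metric (g p) V (velocity (worldsheet left) g p d1)
      = om (g p) V (velocity (worldsheet left) g p d2).

Definition fields : set (R * R -> G) :=
  [set g | [/\ smooth_to (worldsheet left) g,
               forall p, worldsheet left p -> g (p.1, p.2 + 2 * pi) = g p,
               forall s : R, Q (g (0, s)) &
               gluing_condition g]].

Definition fields_eom : set (R * R -> G) :=
  [set g | fields g /\
     forall p, worldsheet left p ->
       deriv_in (worldsheet left) (fun p' => log_deriv g p' dminus) p dplus
       = 0].

(* g d_+ g^-1 is the logarithmic derivative of the pointwise inverse of g *)
Definition J_L (g : R * R -> G) (p : R * R) : 'rV[R]_n :=
  (k%:R / (2 * pi)) *: log_deriv (fun p' => ((g p')^-1)%g) p dplus.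

Definition J_R (g : R * R -> G) (p : R * R) : 'rV[R]_n :=
  (k%:R / (2 * pi)) *: log_deriv g p dminus.

Definition loop_group : set (R -> G) :=
  [set h | smooth_to setT h /\ forall s, h (s + 2 * pi) = h s].

Definition loop_act (h : R -> G) (g : R * R -> G) : R * R -> G :=
  fun p => (h (p.2 + p.1)%R * g p * (h (p.2 - p.1)%R)^-1)%g.

Definition loop_group_acts_on (E : set (R * R -> G)) : Prop :=
  [/\ forall h g, loop_group h -> E g -> E (loop_act h g),
      forall g, E g -> loop_act (fun=> 1%g) g = g &
      forall h h' g, loop_group h -> loop_group h' -> E g ->
        loop_act (fun s => (h s * h' s)%g) g = loop_act h (loop_act h' g)].

Definition currents_glue : Prop :=
  forall g, fields g -> forall s : R, J_R g (0, s) - J_L g (0, s) = 0.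

End Fields.
End TwoForms.
End Background.
End LieGroupTheory.

Arguments dominant_weights {R n} G tr T k {r} S theta.
Arguments conj_class {R n} G k L.
Arguments brane {R n} G tr T k {r} S theta.

(* Main.v *)
(* Both symmetries are expressed through A1 = g^-1 d_1 g and A2 = g^-1 d_2 g at
   the boundary.  There J_R = J_L amounts to A1 - Ad_g A1 = A2 + Ad_g A2, a
   condition preserved by g |-> h g h^-1; for the standard curvature it is
   equivalent to the gluing condition, because (id + Ad_g) / (id - Ad_g) is
   antisymmetric for tr.  Conversely, start from a field that is constant along
   the boundary, with value q.  The loop group action turns it into a field with
   value q whose boundary velocity is an arbitrary tangent vector W; its gluing
   condition reads - metric(V, g_* d_1) = om(V, W), and J_R = J_L determines the
   left-hand side. *)

Require Import Defs.
From HB Require Import structures.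
From mathcomp Require Import all_boot all_order all_algebra.
From mathcomp Require Import all_classical all_reals all_analysis.
From mathcomp Require Import ring lra.

Set Implicit Arguments.
Unset Strict Implicit.
Unset Printing Implicit Defensive.

Import Order.TTheory GRing.Theory Num.Theory.
Import numFieldNormedType.Exports.

Local Open Scope classical_set_scope.
Local Open Scope ring_scope.

(** * Calculus of C^k maps *)

Section CkCalculus.
Variable R : realType.
Implicit Types V W X : normedModType R.

(** At the boundary, transverse derivatives are one-sided and [g] is arbitrary off the worldsheet,
    so the differential of [g] itself is of no use there. Velocities are therefore limits along any
    proper filter finer than the punctured neighbourhoods of 0. The differential of a local smooth
    extension computes them all, which makes them linear in the direction. Left logarithmic
    derivatives then reduce products of group-valued maps to sums in the Lie algebra, twisted by Ad.

    The gluing condition at q tests only vectors tangent to the conjugacy class, which [theta_L]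
    sends onto the image of id - Ad_q. The orthogonal complement of that image is ker (id - Ad_q).
    The condition thus determines A1 exactly up to this kernel, and A1 - Ad_q A1 carries the same
    information: this is why gluing and the matching of currents can be equivalent. *)

Lemma near_eq_diff V W (f g : V -> W) (x : V) :
  {near x, f =1 g} -> differentiable f x ->
  differentiable g x /\ 'd g x = 'd f x :> (V -> W).
Proof.
move=> fg df.
have [dfc dfE] := (diff_locallyP _ _).1 df.
have gE : g \o shift x = cst (g x) + 'd f x +o_ (0 : V) id.
  apply/eqaddoP => _/posnumP[e].
  have /eqaddoP/(_ _ [gt0 of e%:num]) Hf := dfE.
  have fg0 : \forall h \near (0 : V), f (h + x) = g (h + x).
    have : \forall y \near x, f y = g y by exact: fg.
    have -> := @near_shift _ _ 0 x (fun y => f y = g y).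
    by apply: filterS => h /=; rewrite subr0.
  near=> h.
  have -> : (g \o shift x - (cst (g x) + 'd f x)) h =
            (f \o shift x - (cst (f x) + 'd f x)) h.
    rewrite !fctE /=; have -> : f (h + x) = g (h + x) by near: h.
    by rewrite (nbhs_singleton fg).
  by near: h.
have E : 'd g x = 'd f x :> (V -> W) by apply: diff_unique.
split; last exact: E.
have gc : continuous 'd g x by move=> y; rewrite E; exact: dfc.
by apply: (diff_locallyP x g).2; split; [exact: gc|rewrite E; exact: gE].
Unshelve. all: by end_near.
Qed.

Lemma Ck_on_sub k V W (U U' : set V) (f : V -> W) :
  U' `<=` U -> Ck_on k U f -> Ck_on k U' f.
Proof.
elim: k V W U U' f => [|k IH] V W U U' f UU' /=; first by move=> h x /UU'/h.
move=> [df cf]; split; first by move=> x /UU'/df.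
by apply: IH cf => -[x v] [/= /UU' ? ?].
Qed.

Lemma openX (S T : topologicalType) (A : set S) (B : set T) :
  open A -> open B -> open (A `*` B).
Proof.
move=> oA oB; rewrite openE => -[x y] [/= Ax By].
by exists (A, B) => //; split; apply: open_nbhs_nbhs.
Qed.

Lemma openXT V W (U : set V) : open U -> open (U `*` [set: W]).
Proof. by move=> oU; apply: openX => //; exact: openT. Qed.

Lemma Ck_on_ext k V W (U : set V) (f g : V -> W) :
  open U -> (forall x, U x -> f x = g x) -> Ck_on k U f -> Ck_on k U g.
Proof.
elim: k V W U f g => [|k IH] V W U f g oU fg /=.
  move=> cf x Ux; rewrite /prop_for /continuous_at -(fg _ Ux).
  apply: cvg_trans (cf _ Ux); apply: near_eq_cvg.
  by apply: filterS (open_nbhs_nbhs (conj oU Ux)) => y /fg.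
move=> [df cf].
have dfg x : U x -> differentiable g x /\ 'd g x = 'd f x :> (V -> W).
  move=> Ux; apply: near_eq_diff; last exact: df.
  by apply: filterS (open_nbhs_nbhs (conj oU Ux)) => y /fg.
split=> [x /dfg[]//|].
apply: IH cf; first exact: openXT.
by move=> [x v] [/= /dfg[_ ->]].
Qed.

Lemma Ck_onS k V W (U : set V) (f : V -> W) :
  Ck_on k.+1 U f -> Ck_on k U f.
Proof.
elim: k V W U f => [|k IH] V W U f [df cf].
  by move=> x /df; exact: differentiable_continuous.
by split=> //; exact: IH.
Qed.

Lemma Ck_on_cst k V W (U : set V) (w : W) : Ck_on k U (fun=> w : W).
Proof.
elim: k V W U w => [|k IH] V W U w /=.
  by move=> x _; exact: cst_continuous.
split=> [x _|]; first exact: differentiable_cst.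
rewrite (_ : (fun _ => _) = fun=> 0); first exact: IH.
by apply/funext => -[x v] /=; rewrite (diff_cst w x).
Qed.

(** The tangent map of a linear map is that map applied to the second variable, again linear and
    continuous, so the induction closes. *)
Lemma Ck_on_lin k V W (U : set V) (f : {linear V -> W}) :
  continuous f -> Ck_on k U f.
Proof.
elim: k V W U f => [|k IH] V W U f cf /=; first by move=> x _; exact: cf.
split=> [x _|]; first exact: linear_differentiable.
rewrite (_ : (fun _ => _) = f \o snd); last first.
  by apply/funext => -[x v] /=; rewrite diff_lin.
apply: (IH _ _ _ (f \o snd)) => x.
by apply: continuous_comp; [exact: cvg_snd | exact: cf].
Qed.

Lemma Ck_on_linear k V W (U : set V) (f : V -> W) :
  linear f -> continuous f -> Ck_on k U f.
Proof.
move=> lf cf; pose f' : {linear V -> W} :=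
  HB.pack f (GRing.isLinear.Build R V W *:%R f lf).
exact: (@Ck_on_lin _ _ _ _ f').
Qed.

Lemma Ck_on_pair k V W X (U : set V) (f : V -> W) (g : V -> X) :
  open U -> Ck_on k U f -> Ck_on k U g -> Ck_on k U (fun x => (f x, g x)).
Proof.
elim: k V W X U f g => [|k IH] V W X U f g oU /=.
  by move=> cf cg x Ux; apply: cvg_pair; [exact: cf|exact: cg].
move=> [df cf] [dg cg]; split=> [x Ux|].
  by apply: differentiable_pair; [exact: df|exact: dg].
have oU' := @openXT V V U oU.
apply: Ck_on_ext (IH _ _ _ _ _ _ oU' cf cg) => //.
move=> [x v] [/= Ux _]; rewrite diff_pair //; [exact: df|exact: dg].
Qed.

(** The chain rule in functorial form: the tangent map of [g \o f] is that of [g] composed with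
    [(x, v) |-> (f x, 'd f x v)], so the induction hypothesis applies on the product spaces. *)
Lemma Ck_on_comp k V W X (U : set V) (U' : set W) (f : V -> W) (g : W -> X) :
  open U -> open U' -> (forall x, U x -> U' (f x)) ->
  Ck_on k U f -> Ck_on k U' g -> Ck_on k U (g \o f).
Proof.
elim: k V W X U U' f g => [|k IH] V W X U U' f g oU oU' UU' /=.
  move=> cf cg x Ux; apply: continuous_comp; first exact: cf.
  by apply: cg; exact: UU'.
move=> [df cf] [dg cg]; split=> [x Ux|].
  by apply: differentiable_comp; [exact: df|exact: dg (UU' _ Ux)].
have oT := @openXT V V U oU; have oT' := @openXT W W U' oU'.
pose F (p : V * V) := (f p.1, 'd f (p.1) p.2).
apply: (@Ck_on_ext _ _ _ _ ((fun p : W * W => 'd g (p.1) p.2) \o F)) => //.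
  move=> [x v] [/= Ux _]; have dfx := df _ Ux; have dgx := dg _ (UU' _ Ux).
  by rewrite (diff_comp dfx dgx).
apply: (IH) cg => //; first by move=> [x v] [/= /UU' Ux _].
apply: Ck_on_pair => //.
apply: (IH (V * V)%type V W (U `*` [set: V]) U fst f) => //.
- by move=> [x v] [].
- by apply: (@Ck_on_lin _ _ _ _ fst) => x; exact: cvg_fst.
- by apply: Ck_onS; split.
Qed.

Lemma smooth_on_comp V W X (U : set V) (U' : set W) (f : V -> W) (g : W -> X) :
  open U -> open U' -> (forall x, U x -> U' (f x)) ->
  smooth_on U f -> smooth_on U' g -> smooth_on U (g \o f).
Proof.
by move=> oU oU' UU' sf sg k; exact: Ck_on_comp oU oU' UU' (sf k) (sg k).
Qed.

Lemma smooth_on_sub V W (U U' : set V) (f : V -> W) :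
  U' `<=` U -> smooth_on U f -> smooth_on U' f.
Proof. by move=> UU' sf k; exact: Ck_on_sub UU' (sf k). Qed.

Lemma smooth_on_pair V W X (U : set V) (f : V -> W) (g : V -> X) :
  open U -> smooth_on U f -> smooth_on U g -> smooth_on U (fun x => (f x, g x)).
Proof. by move=> oU sf sg k; exact: Ck_on_pair. Qed.

Lemma smooth_on_lin V W (U : set V) (f : {linear V -> W}) :
  continuous f -> smooth_on U f.
Proof. by move=> cf k; exact: Ck_on_lin. Qed.

Lemma smooth_on_cst V W (U : set V) (w : W) : smooth_on U (fun=> w).
Proof. by move=> k; exact: Ck_on_cst. Qed.

Lemma smooth_on_differentiable V W (U : set V) (f : V -> W) (x : V) :
  smooth_on U f -> U x -> differentiable f x.
Proof. by move=> /(_ 1)[df _] /df. Qed.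

Lemma smooth_on_continuous V W (U : set V) (f : V -> W) (x : V) :
  smooth_on U f -> U x -> {for x, continuous f}.
Proof. by move=> /(_ 0) cf /cf. Qed.

Lemma Ck_onD k V W (U : set V) (f g : V -> W) :
  open U -> Ck_on k U f -> Ck_on k U g -> Ck_on k U (fun x => f x + g x).
Proof.
elim: k V U f g => [|k IH] V U f g oU /=.
  by move=> cf cg x Ux; apply: continuousD; [exact: cf|exact: cg].
move=> [df cf] [dg cg]; split=> [x Ux|].
  by apply: differentiableD; [exact: df|exact: dg].
have oU' := @openXT V V U oU.
apply: Ck_on_ext (IH _ _ _ _ oU' cf cg) => //.
by move=> [x v] [/= Ux _]; rewrite diffD //; [exact: df|exact: dg].
Qed.

Lemma Ck_onN k V W (U : set V) (f : V -> W) :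
  open U -> Ck_on k U f -> Ck_on k U (fun x => - f x).
Proof.
elim: k V U f => [|k IH] V U f oU /=.
  by move=> cf x Ux; apply: continuousN; exact: cf.
move=> [df cf]; split=> [x Ux|]; first by apply: differentiableN; exact: df.
have oU' := @openXT V V U oU.
apply: Ck_on_ext (IH _ _ _ oU' cf) => //.
by move=> [x v] [/= Ux _]; rewrite diffN //; exact: df.
Qed.

Lemma Ck_onM k V (U : set V) (f g : V -> R) :
  open U -> Ck_on k U f -> Ck_on k U g -> Ck_on k U (fun x => f x * g x).
Proof.
elim: k V U f g => [|k IH] V U f g oU /=.
  by move=> cf cg x Ux; apply: continuousM; [exact: cf|exact: cg].
move=> cf' cg'; have [df cf] := cf'; have [dg cg] := cg'.
split=> [x Ux|]; first by apply: differentiableM; [exact: df|exact: dg].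
have oU' := @openXT V V U oU.
have c1 (h : V -> R) : Ck_on k.+1 U h -> Ck_on k (U `*` [set: V]) (h \o fst).
  move=> /Ck_onS; apply: Ck_on_comp => //; first by move=> [? ?] [].
  by apply: (@Ck_on_lin _ _ _ _ fst) => x; exact: cvg_fst.
apply: Ck_on_ext (Ck_onD oU' (IH _ _ _ _ oU' (c1 _ cf') cg)
                            (IH _ _ _ _ oU' (c1 _ cg') cf)) => //.
by move=> [x v] [/= Ux _]; rewrite diffM //; [exact: df|exact: dg].
Qed.

(** Each function is the derivative of the other up to sign, hence the simultaneous induction. *)
Lemma Ck_on_sin_cos k :
  Ck_on k setT (sin : R -> R) /\ Ck_on k setT (cos : R -> R).
Proof.
elim: k => [|k [IHs IHc]] /=.
  by split=> x _; [exact: continuous_sin|exact: continuous_cos].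
have c1 (h : R -> R) :
    Ck_on k setT h -> Ck_on k (setT `*` setT) (h \o (fst : R * R -> R)).
  apply: Ck_on_comp => //; first by apply: openX; exact: openT.
    exact: openT.
  by apply: (@Ck_on_lin _ _ _ _ fst) => x; exact: cvg_fst.
have c2 : Ck_on k (setT `*` setT) (snd : R * R -> R).
  by apply: (@Ck_on_lin _ _ _ _ snd) => x; exact: cvg_snd.
have oT : open ([set: R] `*` [set: R]) by apply: openX; exact: openT.
split; split.
- by move=> x _; apply/derivable1_diffP.
- apply: Ck_on_ext (Ck_onM oT c2 (c1 _ IHc)) => //.
  move=> [x v] _ /=; rewrite diff1E; last by apply/derivable1_diffP.
  by rewrite derive1E derive_val.
- by move=> x _; apply/derivable1_diffP.
- apply: Ck_on_ext (Ck_onM oT c2 (Ck_onN oT (c1 _ IHs))) => //.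
  move=> [x v] _ /=; rewrite diff1E; last by apply/derivable1_diffP.
  by rewrite derive1E derive_val.
Qed.

End CkCalculus.

(** * Smooth maps to manifolds *)

Lemma open_setI_preimage (S T : topologicalType) (U : set S) (B : set T)
    (f : S -> T) :
  open U -> open B -> (forall x, U x -> {for x, continuous f}) ->
  open (U `&` f @^-1` B).
Proof.
move=> oU oB cf; rewrite openE => x [Ux Bfx]; apply: filterI.
  exact: open_nbhs_nbhs.
by apply: (cf x Ux); exact: open_nbhs_nbhs.
Qed.

Section SmoothAt.
Variables (R : realType) (n : nat) (M : manifoldType R n).
Implicit Types V W : normedModType R.

Lemma chart_invK (p : M) (u : 'rV[R]_n) :
  chart_img p u -> chart p (chart_inv p u) = u.
Proof. by move=> [q pq <-]; rewrite chartK. Qed.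

Lemma chart_inv_dom (p : M) (u : 'rV[R]_n) :
  chart_img p u -> chart_dom p (chart_inv p u).
Proof. by move=> [q pq <-]; rewrite chartK. Qed.

Lemma chart_img_self (p : M) : chart_img p (chart p p).
Proof. by exists p => //; exact: chart_dom_self. Qed.

Lemma chart_inv_self (p : M) : chart_inv p (chart p p) = p.
Proof. by apply: chartK; exact: chart_dom_self. Qed.

Lemma chart_transition_domE (p q : M) :
  chart p @` (chart_dom p `&` chart_dom q) =
  chart_img p `&` chart_inv p @^-1` (chart_dom q).
Proof.
apply/seteqP; split=> [_ [x [px qx] <-]|u [pu qu]].
  by split; [exists x|rewrite /= chartK].
exists (chart_inv p u); last exact: chart_invK.
by split=> //; exact: chart_inv_dom.
Qed.

(* Unlike in [smooth_to], the chart at an arbitrary point may be used. *)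
Definition smooth_at V (S : set V) (f : V -> M) (x : V) : Prop :=
  exists (p : M) (U : set V) (F : V -> 'rV[R]_n),
    [/\ open U, U x, smooth_on U F, forall y, U y -> chart_img p (F y) &
        forall y, S y -> U y -> f y = chart_inv p (F y)].

Lemma smooth_at_chart V (S : set V) (f : V -> M) (x : V) (q : M) :
  smooth_at S f x -> S x -> chart_dom q (f x) ->
  exists (U : set V) (F : V -> 'rV[R]_n),
    [/\ open U, U x, smooth_on U F, forall y, U y -> chart_img q (F y) &
        forall y, S y -> U y -> f y = chart_inv q (F y)].
Proof.
move=> [p [U [F [oU Ux sF pF fE]]]] Sx qfx.
have otr : open (chart_img p `&` chart_inv p @^-1` (chart_dom q)).
  apply: open_setI_preimage; [exact: chart_img_open|exact: chart_dom_open|].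
  by move=> u pu; exact: chart_inv_continuous.
pose U' := U `&` F @^-1` (chart_img p `&` chart_inv p @^-1` (chart_dom q)).
have oU' : open U'.
  by apply: open_setI_preimage => // y /(smooth_on_continuous sF).
exists U', ((chart q \o chart_inv p) \o F); split=> //.
- by split=> //; split; [exact: pF|rewrite /= -fE].
- apply: (smooth_on_comp oU' otr) => [y [_]//||].
    by apply: smooth_on_sub sF => y [].
  by rewrite -chart_transition_domE; exact: chart_transition.
- by move=> y [Uy [_ qy]]; exists (chart_inv p (F y)).
- by move=> y Sy [Uy [_ qy]]; rewrite (fE y Sy Uy) /= chartK.
Qed.

Lemma smooth_to_at V (S : set V) (f : V -> M) (x : V) :
  smooth_to S f -> S x -> smooth_at S f x.
Proof.
move=> [/subspace_continuousP cf sf] Sx; have [U [F [oU Ux sF FE]]] := sf _ Sx.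
(* Outside its domain the chart does not determine the point; continuity keeps [f y] inside the
   domain for [y] near [x]. *)
have [A Anbhs fA] : exists2 A, nbhs x A &
    forall y, A y -> S y -> chart_dom (f x) (f y).
  exists [set y | S y -> chart_dom (f x) (f y)] => //.
  apply: (cf x Sx); apply: open_nbhs_nbhs.
  by split; [exact: chart_dom_open|exact: chart_dom_self].
move: Anbhs; rewrite nbhsE /= => -[B [oB Bx] BA].
pose U' := B `&` (U `&` F @^-1` (chart_img (f x))).
have oUF : open (U `&` F @^-1` (chart_img (f x))).
  by apply: open_setI_preimage => [||y /(smooth_on_continuous sF)] //;
     exact: chart_img_open.
exists (f x), U', F; split.
- exact: openI.
- by split=> //; split=> //=; rewrite FE //; exact: chart_img_self.
- by apply: smooth_on_sub sF => y [_ []].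
- by move=> y [_ []].
- move=> y Sy [By [Uy _]]; rewrite FE // chartK //.
  by apply: fA => //; exact: BA.
Qed.

Lemma smooth_at_to V (S : set V) (f : V -> M) :
  (forall x, S x -> smooth_at S f x) -> smooth_to S f.
Proof.
move=> sf; split=> [|x Sx].
  apply/subspace_continuousP => x Sx.
  have [p [U [F [oU Ux sF pF fE]]]] := sf _ Sx.
  have : chart_inv p (F y) @[y --> x] --> f x.
    rewrite (fE _ Sx Ux).
    apply: (@continuous_comp _ _ _ F (chart_inv p)).
      exact: (smooth_on_continuous sF).
    by apply: chart_inv_continuous; exact: pF.
  move=> c A /c HA.
  have HA' : nbhs x [set y | A (chart_inv p (F y))] by exact: HA.
  have HB : nbhs x [set y | S y -> A (f y)].
    have := @filterI _ _ (nbhs_filter x) _ _ HA' (open_nbhs_nbhs (conj oU Ux)).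
    by apply: (@filterS _ _ (nbhs_filter x)) => y [/= Ay Uy Sy]; rewrite fE.
  exact: HB.
have [U [F [oU Ux sF pF fE]]] :=
  smooth_at_chart (sf _ Sx) Sx (chart_dom_self (f x)).
exists U, F; split=> // y Sy Uy.
by rewrite (fE y) // chart_invK //; exact: pF.
Qed.

Lemma smooth_at_comp V W (S : set V) (S' : set W) (f : V -> M) (a : W -> V)
    (U : set W) (y : W) :
  open U -> U y -> smooth_on U a -> (forall z, S' z -> U z -> S (a z)) ->
  smooth_at S f (a y) -> smooth_at S' (f \o a) y.
Proof.
move=> oU Uy sa aS [p [U1 [F [oU1 U1x sF pF fE]]]].
have oU' : open (U `&` a @^-1` U1).
  by apply: open_setI_preimage => // z /(smooth_on_continuous sa).
exists p, (U `&` a @^-1` U1), (F \o a); split=> //.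
- apply: (smooth_on_comp oU' oU1) => // [z []//|].
  by apply: smooth_on_sub sa => z [].
- by move=> z [_ /pF].
- by move=> z Sz [Uz U1z] /=; apply: fE => //; exact: aS.
Qed.

Lemma smooth_at_ext V (S U : set V) (f g : V -> M) (x : V) :
  open U -> U x -> (forall y, S y -> U y -> f y = g y) ->
  smooth_at S f x -> smooth_at S g x.
Proof.
move=> oU Ux fg [p [U1 [F [oU1 U1x sF pF fE]]]].
exists p, (U `&` U1), F; split=> //; first exact: openI.
- by apply: smooth_on_sub sF => y [].
- by move=> y [_ /pF].
- by move=> y Sy [Uy U1y]; rewrite -fg // fE.
Qed.

Lemma smooth_at_cst V (S : set V) (a : M) (x : V) : smooth_at S (fun=> a) x.
Proof.
exists a, setT, (fun=> chart a a); split=> //; first exact: openT.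
- exact: smooth_on_cst.
- by move=> _ _; exact: chart_img_self.
- by move=> _ _ _; rewrite chart_inv_self.
Qed.

Lemma smooth_at_chart_inv (p : M) (S : set 'rV[R]_n) (u : 'rV[R]_n) :
  chart_img p u -> smooth_at S (chart_inv p) u.
Proof.
move=> pu; exists p, (chart_img p), id; split=> //.
  exact: chart_img_open.
by apply: (@smooth_on_lin _ _ _ _ idfun) => x; exact: cvg_id.
Qed.

End SmoothAt.

Section SmoothAtLie.
Variables (R : realType) (n : nat) (G : lieGroupType R n).
Implicit Types V W : normedModType R.

Lemma smooth_at_mul V (S : set V) (f g : V -> G) (x : V) :
  smooth_at S f x -> smooth_at S g x ->
  smooth_at S (fun y => (f y * g y)%g) x.
Proof.
move=> [p [U [F [oU Ux sF pF fE]]]] [p' [U' [F' [oU' Ux' sF' pF' fE']]]].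
have oI : open (U `&` U') by exact: openI.
have FF : smooth_on (U `&` U') (fun y => (F y, F' y)).
  apply: smooth_on_pair => //; first by apply: smooth_on_sub sF => y [].
  by apply: smooth_on_sub sF' => y [].
pose m (u : 'rV[R]_n * 'rV[R]_n) : G := (chart_inv p u.1 * chart_inv p' u.2)%g.
apply: (@smooth_at_ext _ _ _ _ S (U `&` U')
  (m \o (fun y => (F y, F' y)))) => //.
  by move=> y Sy [Uy Uy'] /=; rewrite fE // fE'.
apply: (smooth_at_comp (S := chart_img p `*` chart_img p') oI) => //.
  by move=> z _ [Uz Uz']; split; [exact: pF|exact: pF'].
apply: smooth_to_at; first exact: lie_mul_smooth.
by split; [exact: pF|exact: pF'].
Qed.

Lemma smooth_at_inv V (S : set V) (f : V -> G) (x : V) :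
  smooth_at S f x -> smooth_at S (fun y => (f y)^-1%g) x.
Proof.
move=> [p [U [F [oU Ux sF pF fE]]]].
apply: (@smooth_at_ext _ _ _ _ S U
  ((fun u => (chart_inv p u)^-1%g : G) \o F)) => //.
  by move=> y Sy Uy /=; rewrite fE.
apply: (smooth_at_comp (S := chart_img p) oU) => //.
  by move=> z _ /pF.
by apply: smooth_to_at; [exact: lie_inv_smooth|exact: pF].
Qed.

End SmoothAtLie.

(** * Limits of difference quotients along a filter *)

Section QuotientLimits.
Variable R : realType.
Implicit Types V W : normedModType R.

(** The filter may be restricted to the parameters that stay in a domain, which gives one-sided
    derivatives. The base value [w0] is a separate argument because the filters used exclude the
    parameter 0. *)
Definition has_quot V (F : set_system R) (w : R -> V) (w0 X : V) : Prop :=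
  (fun h : R => h^-1 *: (w h - w0)) @ F --> X.

Variables (F : set_system R) (FF : ProperFilter F).
Hypothesis F0 : F `=>` (0 : R)^'.

Lemma near_dnbhs0_neq0 : \forall h \near F, h != 0.
Proof. by apply: F0; exact: withinT. Qed.

Lemma cvg_dnbhs0_id : h @[h --> F] --> (0 : R).
Proof. by apply: cvg_trans F0 _; apply: cvg_within. Qed.

Lemma has_quot_cvg0 V (w : R -> V) (w0 X : V) :
  has_quot F w w0 X -> w h - w0 @[h --> F] --> (0 : V).
Proof.
move=> qw; rewrite -(scale0r X).
have : h *: (h^-1 *: (w h - w0)) @[h --> F] --> 0 *: X.
  by apply: cvgZ qw; exact: cvg_dnbhs0_id.
apply: cvg_trans; apply: near_eq_cvg.
have := near_dnbhs0_neq0; apply: filterS => h h0.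
by rewrite scalerA mulfV // scale1r.
Qed.

Lemma has_quot_cvg V (w : R -> V) (w0 X : V) :
  has_quot F w w0 X -> w h @[h --> F] --> w0.
Proof.
move=> /has_quot_cvg0 qw; rewrite -(add0r w0).
have : w h - w0 + w0 @[h --> F] --> 0 + w0 by apply: cvgD qw _; exact: cvg_cst.
by under eq_cvg do rewrite subrK.
Qed.

Lemma has_quot_unique V (w : R -> V) (w0 X Y : V) :
  has_quot F w w0 X -> has_quot F w w0 Y -> X = Y.
Proof. by apply: cvg_unique; exact: norm_hausdorff. Qed.

Lemma has_quot_ext V (w w' : R -> V) (w0 X : V) :
  (\forall h \near F, w h = w' h) -> has_quot F w w0 X -> has_quot F w' w0 X.
Proof.
move=> ww'; apply: cvg_trans; apply: near_eq_cvg.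
by move: ww'; apply: filterS => h ->.
Qed.

Lemma has_quot_line V (w0 X : V) (k : R) :
  has_quot F (fun h => w0 + (k * h) *: X) w0 (k *: X).
Proof.
have : (fun=> k *: X) @ F --> k *: X by exact: cvg_cst.
apply: cvg_trans; apply: near_eq_cvg.
have := near_dnbhs0_neq0; apply: filterS => h h0.
by rewrite addrC addKr scalerA mulrCA mulVf // mulr1.
Qed.

Lemma has_quot_pair V W (v : R -> V) (v0 X : V) (w : R -> W) (w0 Y : W) :
  has_quot F v v0 X -> has_quot F w w0 Y ->
  has_quot F (fun h => (v h, w h)) (v0, w0) (X, Y).
Proof. by move=> qv qw; apply: cvg_pair qv qw. Qed.

Lemma has_quot_comp V W (f : V -> W) (w : R -> V) (w0 X : V) :
  differentiable f w0 -> has_quot F w w0 X ->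
  has_quot F (f \o w) (f w0) ('d f w0 X).
Proof.
move=> df qw.
have [dfc /eqaddoP dfE] := (diff_locallyP _ _).1 df.
have dq : 'd f w0 (h^-1 *: (w h - w0)) @[h --> F] --> 'd f w0 X.
  by apply: (cvg_comp _ _ qw); exact: dfc.
have nq : `|h^-1 *: (w h - w0)| @[h --> F] --> `|X| by exact: cvg_norm qw.
(* Convergent quotients are eventually bounded by [|X| + 1], so a remainder that is small against
   [w h - w0] stays small after division by [h]. *)
have qb : \forall h \near F, `|h^-1 *: (w h - w0)| < `|X| + 1.
  have X1 : `|X| < `|X| + 1 by rewrite ltrDl.
  exact: (cvgr_lt _ nq _ X1).
suff /cvgr0Pnorm_le r0 : forall e, 0 < e -> \forall h \near F,
    `|h^-1 *: (f (w h) - f w0) - 'd f w0 (h^-1 *: (w h - w0))| <= e.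
  have H := cvgD r0 dq; rewrite add0r in H.
  apply: cvg_trans (H _); apply: near_eq_cvg.
  by apply: nearW => h /=; rewrite !fctE subrK.
move=> e e0.
have X1 : 0 < `|X| + 1 by rewrite ltr_wpDl.
have Hr : \forall h \near F,
    `|(f \o shift w0 - (cst (f w0) + 'd f w0)) (w h - w0)|
     <= e / (`|X| + 1) * `|w h - w0|.
  have c0 : w h - w0 @[h --> F] --> (0 : V) by exact: has_quot_cvg0 qw.
  exact: (c0 _ (dfE _ (divr_gt0 e0 X1))).
near=> h.
have : `|(f \o shift w0 - (cst (f w0) + 'd f w0)) (w h - w0)|
   <= e / (`|X| + 1) * `|w h - w0| by near: h; exact: Hr.
rewrite !fctE /= subrK => Hle.
rewrite linearZ /= -scalerBr -addrA -opprD normrZ.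
apply: (le_trans (ler_wpM2l (normr_ge0 _) Hle)).
rewrite mulrCA -normrZ.
have : `|h^-1 *: (w h - w0)| <= `|X| + 1 by apply: ltW; near: h.
move=> /(ler_wpM2l (ltW (divr_gt0 e0 X1))) /le_trans; apply.
by rewrite divfK // gt_eqF.
Unshelve. all: by end_near.
Qed.

End QuotientLimits.

(** * Velocities of curves *)

Lemma mdiffD (R : realType) (m n : nat) (M : manifoldType R m)
    (N : manifoldType R n) (f : M -> N) (p : M) :
  {morph mdiff f p : V W / V + W}.
Proof. by move=> V W; rewrite /mdiff /tangent_map linearD. Qed.

Lemma mdiffZ (R : realType) (m n : nat) (M : manifoldType R m)
    (N : manifoldType R n) (f : M -> N) (p : M) (a : R) :
  {morph mdiff f p : V / a *: V}.
Proof. by move=> V; rewrite /mdiff /tangent_map linearZ. Qed.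

Section CurveVelocity.
Variables (R : realType) (F : set_system R) (FF : ProperFilter F).
Hypothesis F0 : F `=>` (0 : R)^'.

(** Convergence to [p] is required separately, since coordinates in the chart at [p] mean nothing
    for points outside its domain. *)
Definition has_vel (n : nat) (M : manifoldType R n) (c : R -> M) (p : M)
    (X : 'rV[R]_n) : Prop :=
  c @ F --> p /\ has_quot F (chart p \o c) (chart p p) X.

Lemma has_vel_ext (n : nat) (M : manifoldType R n) (c c' : R -> M) (p : M)
    (X : 'rV[R]_n) :
  (\forall h \near F, c h = c' h) -> has_vel c p X -> has_vel c' p X.
Proof.
move=> cc' [c0 cX]; split.
  apply: cvg_trans c0; apply: near_eq_cvg.
  by move: cc'; apply: filterS => h ->.
apply: has_quot_ext cX.
by move: cc'; apply: filterS => h /= ->.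
Qed.

Lemma has_vel_unique (n : nat) (M : manifoldType R n) (c : R -> M) (p : M)
    (X Y : 'rV[R]_n) : has_vel c p X -> has_vel c p Y -> X = Y.
Proof. by move=> [_ cX] [_ cY]; exact: has_quot_unique cX cY. Qed.

Lemma has_vel_cst (n : nat) (M : manifoldType R n) (p : M) :
  has_vel (fun=> p) p 0.
Proof.
split; first exact: cvg_cst.
by rewrite /has_quot /=; under eq_cvg do rewrite subrr scaler0; exact: cvg_cst.
Qed.

End CurveVelocity.

(** [D] is the differential of a local smooth extension of [f] in the chart at [f x]. It agrees with
    [tangent_map] at interior points; at a boundary point it still gives the velocity of every curve
    that stays in [S], because such curves do not see the values of [f] off [S]. *)
Lemma smooth_at_velE (R : realType) (V : normedModType R) (n : nat)
    (M : manifoldType R n) (S : set V) (f : V -> M) (x : V) :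
  smooth_at S f x -> S x ->
  exists D : {linear V -> 'rV[R]_n}, [/\ continuous D,
    nbhs x S -> forall v, tangent_map f x v = D v &
    forall (F : set_system R), ProperFilter F -> F `=>` (0 : R)^' ->
      forall w X, (\forall h \near F, S (w h)) -> has_quot F w x X ->
      has_vel F (f \o w) (f x) (D X)].
Proof.
move=> sf Sx.
have [U [K [oU Ux sK pK fE]]] := smooth_at_chart sf Sx (chart_dom_self (f x)).
have dK := smooth_on_differentiable sK Ux.
have Kx : K x = chart (f x) (f x).
  by rewrite [X in chart _ X](fE x) // chart_invK //; exact: pK.
exists ('d K x); split=> [|nS v|F FF F0 w X wS wX].
- exact: diff_continuous.
- rewrite /tangent_map.
  have KE : {near x, K =1 chart (f x) \o f}.
    have := @filterI _ _ (nbhs_filter x) _ _ nS (open_nbhs_nbhs (conj oU Ux)).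
    apply: (@filterS _ _ (nbhs_filter x)) => y [/= Sy Uy].
    by rewrite (fE y) // chart_invK //; exact: pK.
  have [_ E] := near_eq_diff KE dK.
  exact: (congr1 (fun g : V -> 'rV[R]_n => g v) E).
have wU : \forall h \near F, U (w h).
  have c0 := has_quot_cvg FF F0 wX.
  exact: (c0 _ (open_nbhs_nbhs (conj oU Ux))).
have fwE : \forall h \near F, chart_inv (f x) (K (w h)) = (f \o w) h.
  by apply: filterS2 wS wU => h Sh Uh /=; rewrite (fE (w h)).
have KwE : \forall h \near F, K (w h) = (chart (f x) \o (f \o w)) h.
  apply: filterS2 wU fwE => h Uh /= <-.
  by rewrite chart_invK //; exact: pK.
have qK := has_quot_comp FF F0 dK wX.
split.
  have : chart_inv (f x) (K (w h)) @[h --> F] --> chart_inv (f x) (K x).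
    apply: (cvg_comp _ _ (has_quot_cvg FF F0 qK)).
    by apply: chart_inv_continuous; exact: pK.
  rewrite -fE //; apply: cvg_trans; apply: near_eq_cvg.
  by move: fwE; apply: filterS => h ->.
by rewrite -Kx; apply: has_quot_ext qK.
Qed.

Section CurveVelocityMaps.
Variables (R : realType) (F : set_system R) (FF : ProperFilter F).
Hypothesis F0 : F `=>` (0 : R)^'.

Lemma has_vel_dom (n : nat) (M : manifoldType R n) (c : R -> M) (p : M)
    (X : 'rV[R]_n) : has_vel F c p X -> \forall h \near F, chart_dom p (c h).
Proof.
move=> [c0 _].
have /c0 : nbhs p (chart_dom p).
  apply: open_nbhs_nbhs.
  by split; [exact: chart_dom_open|exact: chart_dom_self].
by [].
Qed.

Lemma chart_img_nbhs (n : nat) (M : manifoldType R n) (p : M) :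
  nbhs (chart p p) (chart_img p).
Proof.
by apply: open_nbhs_nbhs; split; [exact: chart_img_open|exact: chart_img_self].
Qed.

Lemma has_vel_mdiff (m n : nat) (M : manifoldType R m) (N : manifoldType R n)
    (f : M -> N) (p : M) (c : R -> M) (X : 'rV[R]_m) :
  smooth_at (chart_img p) (f \o chart_inv p) (chart p p) ->
  has_vel F c p X -> has_vel F (f \o c) (f p) (mdiff f p X).
Proof.
move=> sf cX; have cp := has_vel_dom cX; have [c0 qX] := cX.
have [D [_ DE Dv]] := smooth_at_velE sf (chart_img_self p).
have := Dv _ FF F0 _ _ _ qX; rewrite /= chart_inv_self -(DE (chart_img_nbhs p)).
move=> H; apply: has_vel_ext (H _).
  by move: cp; apply: filterS => h ph /=; rewrite chartK.
by move: cp; apply: filterS => h ph; exists (c h).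
Qed.

Lemma has_vel_chart_inv (n : nat) (M : manifoldType R n) (p : M)
    (w : R -> 'rV[R]_n) (X : 'rV[R]_n) :
  has_quot F w (chart p p) X -> has_vel F (chart_inv p \o w) p X.
Proof.
move=> qw; have c1 := has_quot_cvg FF F0 qw.
split.
  rewrite -[X in _ --> X](chart_inv_self p); apply: (cvg_comp _ _ c1).
  by apply: chart_inv_continuous; exact: chart_img_self.
have : \forall h \near F, chart_img p (w h) by exact: (c1 _ (chart_img_nbhs p)).
move=> pX; apply: has_quot_ext qw.
by move: pX; apply: filterS => h ph /=; rewrite chart_invK.
Qed.

Lemma has_vel_line (n : nat) (M : manifoldType R n) (p : M) (X : 'rV[R]_n) :
  has_vel F (fun h => chart_inv p (chart p p + (1 * h) *: X)) p X.
Proof.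
apply: has_vel_chart_inv; rewrite -[X in has_quot _ _ _ X]scale1r.
exact: has_quot_line.
Qed.

End CurveVelocityMaps.

(** * Velocities in a Lie group and the adjoint action *)

Section LieVelocity.
Variables (R : realType) (n : nat) (G : lieGroupType R n).
Implicit Types (a b x : G) (X Y V W : 'rV[R]_n).

Lemma smooth_at_lmul x p :
  smooth_at (chart_img p) ((fun y : G => (x * y)%g) \o chart_inv p) (chart p p).
Proof.
apply: smooth_at_mul; first exact: smooth_at_cst.
by apply: smooth_at_chart_inv; exact: chart_img_self.
Qed.

Lemma smooth_at_conj x p :
  smooth_at (chart_img p) ((fun y : G => (x * y * x^-1)%g) \o chart_inv p)
    (chart p p).
Proof.
apply: smooth_at_mul; last exact: smooth_at_cst.
exact: smooth_at_lmul.
Qed.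

Lemma smooth_at_orbit q p :
  smooth_at (chart_img p) ((fun y : G => (y * q * y^-1)%g) \o chart_inv p)
    (chart p p).
Proof.
have si := smooth_at_chart_inv (chart_img p) (chart_img_self p).
apply: smooth_at_mul; last exact: smooth_at_inv.
by apply: smooth_at_mul; last exact: smooth_at_cst.
Qed.

Section AlongFilter.
Variables (F : set_system R) (FF : ProperFilter F).
Hypothesis F0 : F `=>` (0 : R)^'.

(** The differential [D] of the multiplication at (1, 1) is linear, and freezing one factor at 1
    shows that each of its partial maps is the identity. *)
Lemma has_vel_mul1 (c d : R -> G) X Y :
  has_vel F c 1%g X -> has_vel F d 1%g Y ->
  has_vel F (fun h => (c h * d h)%g) 1%g (X + Y).
Proof.
move=> cX dY.
pose m (u : 'rV[R]_n * 'rV[R]_n) : G :=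
  (chart_inv (1 : G)%g u.1 * chart_inv (1 : G)%g u.2)%g.
pose u0 := chart (1 : G)%g 1%g.
have m0 : m (u0, u0) = 1%g by rewrite /m /= chart_inv_self mul1g.
have im0 : (chart_img (1 : G)%g `*` chart_img (1 : G)%g) (u0, u0).
  by split; exact: chart_img_self.
have sm := smooth_to_at (@lie_mul_smooth R n G 1%g 1%g) im0.
have [D [_ _ Dv]] := smooth_at_velE sm im0.
have key (c1 c2 : R -> G) X1 X2 : has_vel F c1 1%g X1 -> has_vel F c2 1%g X2 ->
    has_vel F (fun h => (c1 h * c2 h)%g) 1%g (D (X1, X2)).
  move=> v1 v2.
  have d1 := has_vel_dom v1; have d2 := has_vel_dom v2.
  have := Dv _ FF F0 _ _ _ (has_quot_pair FF v1.2 v2.2).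
  rewrite -/(m _) m0 => H; apply: has_vel_ext (H _).
    by apply: filterS2 d1 d2 => h h1 h2 /=; rewrite !chartK.
  by apply: filterS2 d1 d2 => h h1 h2; split; [exists (c1 h)|exists (c2 h)].
have -> : X + Y = D (X, Y).
  have -> : D (X, Y) = D (X, 0) + D (0, Y).
    by rewrite -linearD; congr (D (_, _)); rewrite ?addr0 ?add0r.
  congr (_ + _).
    have := key _ _ _ _ cX (has_vel_cst FF (1 : G)%g).
    under eq_fun do rewrite mulg1.
    exact: has_vel_unique cX.
  have := key _ _ _ _ (has_vel_cst FF (1 : G)%g) dY.
  under eq_fun do rewrite mul1g.
  exact: has_vel_unique dY.
exact: key.
Qed.

Lemma has_vel_inv1 (c : R -> G) X :
  has_vel F c 1%g X -> has_vel F (fun h => (c h)^-1%g) 1%g (- X).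
Proof.
move=> cX.
have si : smooth_at (chart_img (1 : G)%g)
    ((fun y : G => (y^-1)%g) \o chart_inv (1 : G)%g) (chart (1 : G)%g 1%g).
  by apply: smooth_at_inv; apply: smooth_at_chart_inv; exact: chart_img_self.
have := has_vel_mdiff FF F0 si cX; rewrite invg1.
set Y := mdiff _ _ _ => cY.
suff -> : - X = Y by [].
have := has_vel_mul1 cX cY; rewrite /=.
under eq_fun do rewrite mulgV.
move=> /(has_vel_unique FF (has_vel_cst FF (1 : G)%g)) /esym /eqP.
by rewrite addrC addr_eq0 => /eqP ->.
Qed.

Lemma has_vel_conj1 x (c : R -> G) X :
  has_vel F c 1%g X -> has_vel F (fun h => (x * c h * x^-1)%g) 1%g (Ad x X).
Proof.
move=> cX; have := has_vel_mdiff FF F0 (smooth_at_conj x 1%g) cX.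
by rewrite mulg1 mulgV.
Qed.

Lemma has_vel_theta (c : R -> G) a V :
  has_vel F c a V -> has_vel F (fun h => (a^-1 * c h)%g) 1%g (theta_L a V).
Proof.
move=> cV; have := has_vel_mdiff FF F0 (smooth_at_lmul a^-1%g a) cV.
by rewrite mulVg.
Qed.

End AlongFilter.
End LieVelocity.

Section AdjointAction.
Variables (R : realType) (n : nat) (G : lieGroupType R n).
Implicit Types (a b x q : G) (X Y Z V W : 'rV[R]_n).

Let F0 : (0 : R)^' `=>` (0 : R)^'. Proof. by []. Qed.
Let PF : ProperFilter (0 : R)^' := Proper_dnbhs_numFieldType (0 : R).

(** Identities between differentials, such as [Ad1] and [AdM], follow by realising [X] as the
    velocity of a curve and writing one image curve in two ways. *)
Lemma has_vel_line1 X : exists c : R -> G, has_vel (0 : R)^' c 1%g X.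
Proof.
exists (fun h => chart_inv 1%g (chart (1 : G)%g 1%g + (1 * h) *: X)).
exact: has_vel_line.
Qed.

Lemma Ad1 X : Ad (1 : G)%g X = X.
Proof.
have [c cX] := has_vel_line1 X.
apply: (has_vel_unique PF _ cX).
apply: has_vel_ext (has_vel_conj1 PF F0 1%g cX).
by apply: nearW => h; rewrite mul1g invg1 mulg1.
Qed.

Lemma AdM x y X : Ad (x * y)%g X = Ad x (Ad y X).
Proof.
have [c cX] := has_vel_line1 X.
apply: (has_vel_unique PF (has_vel_conj1 PF F0 _ cX)).
apply: has_vel_ext (has_vel_conj1 PF F0 x (has_vel_conj1 PF F0 y cX)).
by apply: nearW => h; rewrite invgM !mulgA.
Qed.

Lemma AdK x : cancel (Ad x) (@Ad R n G x^-1%g).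
Proof. by move=> X; rewrite -AdM mulVg Ad1. Qed.

Lemma AdVK x : cancel (Ad x^-1%g) (@Ad R n G x).
Proof. by move=> X; rewrite -AdM mulgV Ad1. Qed.

Lemma AdD x : {morph @Ad R n G x : X Y / X + Y}.
Proof. exact: mdiffD. Qed.

Lemma AdZ x (k : R) : {morph @Ad R n G x : X / k *: X}.
Proof. exact: mdiffZ. Qed.

Lemma AdN x : {morph @Ad R n G x : X / - X}.
Proof. by move=> X; rewrite -scaleN1r AdZ scaleN1r. Qed.

Lemma AdB x : {morph @Ad R n G x : X Y / X - Y}.
Proof. by move=> X Y; rewrite AdD AdN. Qed.

Lemma Ad_continuous x : continuous (@Ad R n G x).
Proof.
have [D [cD DE _]] := smooth_at_velE (smooth_at_conj x 1%g)
  (chart_img_self (1 : G)%g).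
have -> // : @Ad R n G x = D.
by apply/funext => X; rewrite -DE //; exact: chart_img_nbhs.
Qed.

Lemma mul_Ad_mx x X : X *m Ad_mx x = Ad x X.
Proof.
exact: (mul_rV_lin1 ('d (chart _ \o ((fun y : G => (x * y * x^-1)%g)
  \o chart_inv 1%g)) (chart (1 : G)%g 1%g)) X).
Qed.

Definition ltrans x X : 'rV[R]_n := mdiff (fun y : G => (x * y)%g) 1%g X.

Lemma theta_LK x : cancel (@theta_L R n G x) (ltrans x).
Proof.
move=> V; have cV := has_vel_line PF F0 x V.
have := has_vel_mdiff PF F0 (smooth_at_lmul x 1%g) (has_vel_theta PF F0 cV).
rewrite mulg1 -/(ltrans _ _) => cV'; apply: (has_vel_unique PF _ cV).
by apply: has_vel_ext cV'; apply: nearW => h; rewrite /= mulgA mulgV mul1g.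
Qed.

Lemma has_vel_ltrans F (FF : ProperFilter F) (F0' : F `=>` (0 : R)^')
    (c : R -> G) x X :
  has_vel F (fun h => (x^-1 * c h)%g) 1%g X -> has_vel F c x (ltrans x X).
Proof.
move=> cX; have := has_vel_mdiff FF F0' (smooth_at_lmul x 1%g) cX.
rewrite mulg1 -/(ltrans _ _); apply: has_vel_ext.
by apply: nearW => h; rewrite /= mulgA mulgV mul1g.
Qed.

Lemma ltransK x : cancel (ltrans x) (@theta_L R n G x).
Proof.
move=> X; have [c cX] := has_vel_line1 X.
have cX' : has_vel (0 : R)^' (fun h => (x^-1 * (x * c h))%g) 1%g X.
  by apply: has_vel_ext cX; apply: nearW => h; rewrite mulgA mulVg mul1g.
exact: (has_vel_unique PF (has_vel_theta PF F0 (has_vel_ltrans PF F0 cX')) cX').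
Qed.

End AdjointAction.

(** * Left logarithmic derivatives of curves *)

Section LogVelocity.
Variables (R : realType) (n : nat) (G : lieGroupType R n).
Implicit Types (a b x q : G) (X Y Z V W : 'rV[R]_n).
Variables (F : set_system R) (FF : ProperFilter F).
Hypothesis F0 : F `=>` (0 : R)^'.

Definition log_vel (c : R -> G) a X : Prop :=
  has_vel F (fun h => (a^-1 * c h)%g) 1%g X.

Lemma log_vel_unique (c : R -> G) a X Y :
  log_vel c a X -> log_vel c a Y -> X = Y.
Proof. exact: has_vel_unique. Qed.

Lemma has_velE (c : R -> G) a V : has_vel F c a V <-> log_vel c a (theta_L a V).
Proof.
split; first exact: has_vel_theta.
by move=> /(has_vel_ltrans FF F0); rewrite theta_LK.
Qed.

Lemma log_velE (c : R -> G) a X : log_vel c a X <-> has_vel F c a (ltrans a X).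
Proof. by rewrite has_velE ltransK. Qed.

Lemma log_vel_cst a : log_vel (fun=> a) a 0.
Proof. by rewrite /log_vel mulVg; exact: has_vel_cst. Qed.

(** [(a b)^-1 c d] is the product of [b^-1 (a^-1 c) b] and [b^-1 d], two curves through 1. *)
Lemma log_vel_mul (c d : R -> G) a b X Y :
  log_vel c a X -> log_vel d b Y ->
  log_vel (fun h => (c h * d h)%g) (a * b)%g (Ad b^-1%g X + Y).
Proof.
move=> cX dY.
apply: has_vel_ext (has_vel_mul1 FF F0 (has_vel_conj1 FF F0 b^-1%g cX) dY).
apply: nearW => h.
by rewrite invgM invgK !mulgA mulgK.
Qed.

Lemma log_vel_inv (c : R -> G) a X :
  log_vel c a X -> log_vel (fun h => (c h)^-1%g) a^-1%g (- Ad a X).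
Proof.
move=> cX; rewrite -AdN.
apply: has_vel_ext (has_vel_conj1 FF F0 a (has_vel_inv1 FF F0 cX)).
by apply: nearW => h; rewrite invgM !invgK !mulgA mulgK.
Qed.

(** This has the shape of the loop action; [c] and [e] are distinct because h^+ and h^- vary
    differently along a given direction. *)
Lemma log_vel_conj (c d e : R -> G) a b x X Y Z :
  log_vel c a X -> log_vel d b Y -> log_vel e x Z ->
  log_vel (fun h => (c h * d h * (e h)^-1)%g) (a * b * x^-1)%g
    (Ad x (Ad b^-1%g X + Y - Z)).
Proof.
move=> cX dY eZ; rewrite AdB.
by have := log_vel_mul (log_vel_mul cX dY) (log_vel_inv eZ); rewrite invgK.
Qed.

End LogVelocity.

(** * Tangent spaces of conjugacy classes *)

Section TangentClass.
Variables (R : realType) (n : nat) (G : lieGroupType R n).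
Implicit Types (q : G) (X Y Z V W : 'rV[R]_n).

Definition orbit_diff q Z : 'rV[R]_n :=
  mdiff (fun x : G => (x * q * x^-1)%g) 1%g Z.

Lemma theta_orbit_diff q Z : theta_L q (orbit_diff q Z) = Ad q^-1%g Z - Z.
Proof.
have PF : ProperFilter (0 : R)^' := Proper_dnbhs_numFieldType (0 : R).
have F0 : (0 : R)^' `=>` (0 : R)^' by [].
have [c cZ] := @has_vel_line1 R n G Z.
have := has_vel_mdiff PF F0 (smooth_at_orbit q 1%g) cZ.
rewrite mul1g invg1 mulg1 -/(orbit_diff q Z) => /(has_velE PF F0) cV.
apply: (log_vel_unique PF cV).
have cZ' : log_vel (0 : R)^' c 1%g Z.
  by apply: has_vel_ext cZ; apply: nearW => h; rewrite invg1 mul1g.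
have := log_vel_conj PF F0 cZ' (log_vel_cst PF q) cZ'.
by rewrite Ad1 mul1g invg1 mulg1 addr0.
Qed.

Lemma tangent_classP q V :
  tangent_class q V <-> exists Z, theta_L q V = Ad q^-1%g Z - Z.
Proof.
split=> [[Z _ <-]|[Z VZ]]; first by exists Z; exact: theta_orbit_diff.
exists Z => //; apply: (can_inj (theta_LK q)).
by rewrite VZ -theta_orbit_diff.
Qed.

End TangentClass.

(** * Invariant trace forms *)

Section TraceForm.
Variables (R : realType) (n : nat) (G : lieGroupType R n).
Variables (tr : 'rV[R]_n -> 'rV[R]_n -> R) (t : 'M[R]_n).
Hypothesis tr_form : trace_form G tr t.
Implicit Types (q : G) (X Y Z V W : 'rV[R]_n).

Lemma trC X Y : tr X Y = tr Y X.
Proof. by have [_ + _ _ _] := tr_form; apply. Qed.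

Lemma trDl X Y Z : tr (X + Y) Z = tr X Z + tr Y Z.
Proof.
by have [+ _ _ _ _] := tr_form; move=> /(_ 1 X Y Z); rewrite scale1r mul1r.
Qed.

Lemma tr0l Z : tr 0 Z = 0.
Proof.
by have /eqP := trDl 0 0 Z; rewrite addr0 -subr_eq subrr eq_sym => /eqP.
Qed.

Lemma trZl k X Z : tr (k *: X) Z = k * tr X Z.
Proof.
have [+ _ _ _ _] := tr_form; move=> /(_ k X 0 Z).
by rewrite addr0 tr0l addr0.
Qed.

Lemma trNl X Z : tr (- X) Z = - tr X Z.
Proof. by rewrite -scaleN1r trZl mulN1r. Qed.

Lemma tr_suml (u : 'rV[R]_n) (A : 'I_n -> 'rV[R]_n) Z :
  tr (\sum_i u 0 i *: A i) Z = \sum_i u 0 i * tr (A i) Z.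
Proof.
elim/big_rec2: _ => [|i x Y _ <-]; first exact: tr0l.
by rewrite trDl trZl.
Qed.

Lemma trBl X Y Z : tr (X - Y) Z = tr X Z - tr Y Z.
Proof. by rewrite trDl trNl. Qed.

Lemma trDr X Y Z : tr X (Y + Z) = tr X Y + tr X Z.
Proof. by rewrite trC trDl trC (trC Z). Qed.

Lemma trBr X Y Z : tr X (Y - Z) = tr X Y - tr X Z.
Proof. by rewrite trC trBl trC (trC Z). Qed.

Lemma tr_Ad q X Y : tr (Ad q X) (Ad q Y) = tr X Y.
Proof. by have [_ _ + _ _] := tr_form; apply. Qed.

Lemma basis_decomp X : exists u : 'rV[R]_n, X = \sum_i u 0 i *: row i t.
Proof.
have [_ _ _ tu _] := tr_form.
by exists (X *m invmx t); rewrite -mulmx_sum_row mulmxKV.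
Qed.

Lemma tr_row_coord i (u : 'rV[R]_n) :
  tr (\sum_j u 0 j *: row j t) (row i t) = - 2^-1 * u 0 i.
Proof.
have [_ _ _ _ tij] := tr_form.
rewrite tr_suml (bigD1 i) //= big1 ?addr0 => [|j ji].
  by rewrite tij eqxx mulr1 mulrC.
by rewrite tij (negbTE ji) !mulr0.
Qed.

Lemma tr_nondeg X : (forall Y, tr Y X = 0) -> X = 0.
Proof.
move=> X0; have [u uE] := basis_decomp X.
rewrite uE big1 // => i _; have := X0 (row i t).
rewrite trC uE tr_row_coord => /eqP; rewrite mulf_eq0 oppr_eq0 invr_eq0.
by rewrite pnatr_eq0 /= => /eqP ->; rewrite scale0r.
Qed.

Lemma tr_represent (l : {scalar 'rV[R]_n}) : exists X, forall Y, tr Y X = l Y.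
Proof.
(* The factor -2 inverts the normalisation -1/2 of the generators. *)
pose v : 'rV[R]_n := \row_i (- 2 * l (row i t)).
exists (\sum_i v 0 i *: row i t) => Y.
have [u {1 2}->] := basis_decomp Y.
rewrite tr_suml linear_sum; apply: eq_bigr => i _ /=.
rewrite linearZ /=; congr (_ * _).
by rewrite trC tr_row_coord mxE; field.
Qed.

(** [Z] is the preimage chosen by [pinvmx]; it may differ from [Y] by a vector fixed by [Ad q]. *)
Lemma cayley_AdP q X Y : X = Y - Ad q Y ->
  exists Z, X = Z - Ad q Z /\ cayley_Ad q X = Z + Ad q Z.
Proof.
move=> XY; exists (X *m pinvmx (1%:M - Ad_mx q)); split.
  rewrite -mul_Ad_mx -[X in _ = X - _]mulmx1 -mulmxBr mulmxKpV //.
  by rewrite XY -mul_Ad_mx -[X in (X - _ <= _)%MS]mulmx1 -mulmxBr submxMl.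
by rewrite /cayley_Ad mulmxDr mulmx1 mul_Ad_mx.
Qed.

(** For [V = X - Ad q X], invariance reduces [tr V (Z + Ad q Z)] to [tr X (Ad q Z) - tr (Ad q X) Z],
    which is antisymmetric in [X] and [Z]. The two terms of the curvature therefore reinforce each
    other, hence the factor 2. *)
Lemma cayley_Ad_tr q W Y : W = Y - Ad q Y ->
  exists Z, W = Z - Ad q Z /\ forall U V, V = U - Ad q U ->
    tr V (cayley_Ad q W) - tr W (cayley_Ad q V) = 2 * tr V (Z + Ad q Z).
Proof.
move=> /cayley_AdP[Z [WZ ->]]; exists Z; split=> // U V /cayley_AdP[X [VX ->]].
rewrite WZ VX !trBl !trDr !tr_Ad (trC Z X) (trC (Ad q Z) X) (trC Z (Ad q X)).
ring.
Qed.

(** By invariance the adjoint of [Ad q] for [tr] is its inverse; by nondegeneracy, a vector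
    orthogonal to the image of id - Ad q is fixed by this inverse, hence by [Ad q]. *)
Lemma orth_im_fixed q X : (forall Y, tr (Y - Ad q Y) X = 0) <-> Ad q X = X.
Proof.
split=> [X0|XE Y]; last by rewrite trBl -{2}XE tr_Ad subrr.
apply/esym/eqP; rewrite -subr_eq0; apply/eqP/tr_nondeg => Y.
have := X0 (Ad q^-1%g Y); rewrite AdVK trBl => /eqP.
by rewrite subr_eq0 -(tr_Ad q) AdVK trBr => /eqP ->; rewrite subrr.
Qed.

(** With [A2 = Z - Ad q Z], the vector [A2 + Ad q A2] is the image of [Z + Ad q Z] under id - Ad q.
    The first equation thus says that [A1 - (Z + Ad q Z)] is fixed by [Ad q], that is, orthogonal to
    every [V = U - Ad q U]; [cayley_Ad_tr] expresses the pairing of [V] with [Z + Ad q Z] through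
    the Cayley operator. *)
Lemma standard_pairing q (A1 A2 Y : 'rV[R]_n) : A2 = Y - Ad q Y ->
  A1 - Ad q A1 = A2 + Ad q A2 <->
  forall V U, V = U - Ad q U ->
    2 * tr V A1 = tr V (cayley_Ad q A2) - tr A2 (cayley_Ad q V).
Proof.
move=> /cayley_Ad_tr[Z [A2Z key]].
have two0 : (2 : R) != 0 by rewrite pnatr_eq0.
have -> : (A1 - Ad q A1 = A2 + Ad q A2) <->
    Ad q (A1 - (Z + Ad q Z)) = A1 - (Z + Ad q Z).
  rewrite A2Z !(AdB, AdD); split=> /eqP; rewrite -subr_eq0 => /eqP E; apply/eqP.
    rewrite -subr_eq0 -oppr_eq0 -{}[X in _ == X]E; apply/eqP.
    by apply/rowP => i; rewrite !mxE; ring.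
  rewrite -subr_eq0 -oppr_eq0 -{}[X in _ == X]E; apply/eqP.
  by apply/rowP => i; rewrite !mxE; ring.
rewrite -orth_im_fixed; split=> H.
  by move=> V U VU; rewrite (key _ _ VU) VU; move/eqP: (H U);
     rewrite trBr subr_eq0 => /eqP ->.
move=> U; have := H _ U erefl; rewrite (key U _ erefl) => /(mulfI two0) E.
by rewrite trBr E subrr.
Qed.

End TraceForm.

(** * Loops and fields on the worldsheet *)

Section Loops.
Variables (R : realType) (n : nat) (G : lieGroupType R n).
Implicit Types (h : R -> G) (s : R) (Z : 'rV[R]_n).

Definition loop_log_deriv h s : 'rV[R]_n := theta_L (h s) (tangent_map h s 1).

Lemma loop_log_vel F (FF : ProperFilter F) (F0 : F `=>` (0 : R)^') h
    (w : R -> R) s (kappa : R) :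
  smooth_to setT h -> has_quot F w s kappa ->
  log_vel F (h \o w) (h s) (kappa *: loop_log_deriv h s).
Proof.
move=> sh qw; have sh' := smooth_to_at sh (I : setT s).
have [D [_ DE Dv]] := smooth_at_velE sh' I.
have hw : has_vel F (h \o w) (h s) (D kappa).
  by apply: Dv => //; exact: nearW.
have := (has_velE FF F0 _ _ _).1 hw.
rewrite /loop_log_deriv DE; last exact: filterT.
have -> : D kappa = kappa *: D 1 by rewrite -linearZ /= /GRing.scale /= mulr1.
by rewrite /theta_L mdiffZ.
Qed.

(** In the chart at 1 the loop oscillates along [Z] like [sin (N s) / N]: the integer frequency
    gives the period 2 pi, and the slope at 0 is 1 whatever [N] is. *)
Lemma exists_loop Z : exists h : R -> G,
  [/\ loop_group h, h 0 = 1%g & loop_log_deriv h 0 = Z].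
Proof.
pose u0 := chart (1 : G)%g 1%g.
have /nbhs_ballP[e /= e0 eP] := chart_img_nbhs (1 : G)%g.
pose N := (Num.bound (`|Z| / e)).+1.
have N0 : 0 < (N%:R : R) by rewrite ltr0n.
have ZN : `|Z| < N%:R * e.
  rewrite -ltr_pdivrMr //; apply: (lt_trans (archi_boundP _)).
    by rewrite divr_ge0 // ltW.
  by rewrite ltr_nat.
(* The factor 1 / N keeps the curve in the chart. *)
pose a s := u0 + (sin (N%:R * s) / N%:R) *: Z.
have aP s : chart_img (1 : G)%g (a s).
  apply: eP; rewrite -ball_normE /= /a opprD addrA subrr sub0r normrN.
  rewrite normrZ normrM normfV (gtr0_norm N0) mulrAC ltr_pdivrMr // mulrC.
  rewrite [e * _]mulrC.
  apply: le_lt_trans ZN; rewrite -[leRHS]mulr1; apply: ler_wpM2l => //.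
  by rewrite ler_norml sin_geN1 sin_le1.
have a0 : a 0 = u0 by rewrite /a mulr0 sin0 mul0r scale0r addr0.
have sa : smooth_on setT a.
  move=> k; apply: Ck_onD; [exact: openT|exact: Ck_on_cst|].
  have cZ : continuous (fun r : R => r *: Z : 'rV[R]_n).
    by move=> r; apply: cvgZr_tmp; exact: cvg_id.
  have lZ : Ck_on k setT (fun r : R => r *: Z).
    by apply: Ck_on_linear cZ => c x y; rewrite scalerDl scalerA.
  apply: (@Ck_on_comp R k _ _ _ setT setT
    (fun s => sin (N%:R * s) / N%:R)) lZ => //; try exact: openT.
  apply: Ck_onM; [exact: openT| |exact: Ck_on_cst].
  apply: (@Ck_on_comp R k _ _ _ setT setT (fun s => N%:R * s))
    (Ck_on_sin_cos R k).1 => //; try exact: openT.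
  apply: Ck_onM; [exact: openT|exact: Ck_on_cst|].
  by apply: (@Ck_on_lin _ _ _ _ setT idfun) => x; exact: cvg_id.
exists (chart_inv (1 : G)%g \o a).
have sh : smooth_to setT (chart_inv (1 : G)%g \o a).
  apply: smooth_at_to => s _.
  apply: (smooth_at_comp (S := setT) (@openT R)) => //.
  by apply: smooth_at_chart_inv; exact: aP.
have h0 : (chart_inv (1 : G)%g \o a) 0 = 1%g by rewrite /= a0 chart_inv_self.
split=> //.
  split=> // s; rewrite /= /a; congr (chart_inv _ (_ + (_ / _) *: _)).
  rewrite mulrDr mulr_natl; have -> : N%:R * (2 * pi) = (pi *+ 2) *+ N :> R.
    by rewrite mulr_natl mulr_natl.
  by rewrite -mulr_natl (periodicn (@sinD2pi R)).
have PF : ProperFilter (0 : R)^' := Proper_dnbhs_numFieldType (0 : R).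
have F0 : (0 : R)^' `=>` (0 : R)^' by [].
have q0 : has_quot (0 : R)^' id (0 : R) 1.
  have := @has_quot_line _ _ PF F0 _ (0 : R) 1 1; rewrite scale1r.
  apply: has_quot_ext; apply: nearW => r.
  by rewrite add0r mul1r /GRing.scale /= mulr1.
have L1 := loop_log_vel PF F0 sh q0.
rewrite scale1r h0 in L1; apply: (log_vel_unique PF L1).
have qs : has_quot (0 : R)^' (fun s => sin (N%:R * s) / N%:R) (0 : R) 1.
  pose f s : R := sin (N%:R * s) / N%:R.
  have [df dE] : is_derive (0 : R) 1 f 1.
    rewrite /f; apply: is_derive_eq.
    rewrite mulr0 cos0 /GRing.scale /=.
    by rewrite mulr0 add0r mul1r mulr1 mulVf // gt_eqF.
  have H : h^-1 *: ((f \o shift 0) (h *: 1) - f 0) @[h --> (0 : R)^']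
      --> 'D_1 f 0.
    exact: df.
  rewrite dE in H; apply: cvg_trans H; apply: near_eq_cvg; apply: nearW => r /=.
  by rewrite /f /GRing.scale /= mulr1 addr0 mulr0 sin0 mul0r.
have qa : has_quot (0 : R)^' a (chart (1 : G)%g 1%g) Z.
  rewrite -[X in has_quot _ _ _ X]scale1r.
  have H : (h^-1 *: (sin (N%:R * h) / N%:R - 0)) *: Z @[h --> (0 : R)^']
      --> 1 *: Z.
    exact: cvgZr_tmp qs.
  apply: cvg_trans H; apply: near_eq_cvg; apply: nearW => r /=.
  rewrite subr0 /a [_ - chart _ _]addrC addKr.
  by symmetry; exact: (scalerA r^-1 (sin (N%:R * r) / N%:R) Z).
apply: has_vel_ext (has_vel_chart_inv PF F0 qa).
by apply: nearW => r; rewrite /= invg1 mul1g.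
Qed.

End Loops.

Section Worldsheet.
Variables (R : realType) (n : nat) (G : lieGroupType R n) (left : bool).
Implicit Types (p v : R * R) (X Y Z : 'rV[R]_n) (g : R * R -> G).
Local Notation S := (@worldsheet R left).

Definition ray p v : set_system R :=
  within [set h : R | S (p + h *: v)] (0 : R)^'.

Lemma ray_dnbhs p v : ray p v `=>` (0 : R)^'.
Proof. exact: cvg_within. Qed.

Lemma ray_in p v : \forall h \near ray p v, S (p + h *: v).
Proof. exact: withinT. Qed.

(** From any of its points, a half-plane contains the half-line along [v] or the one along [- v], so
    arbitrarily small nonzero parameters remain. *)
Lemma ray_proper p v : S p -> ProperFilter (ray p v).
Proof.
move=> Sp; apply: Build_ProperFilter.
rewrite /ray /within /= => -[e /= e0 eP].
have [h [he h0 Sh]] : exists h : R, [/\ `|h| < e, h != 0 & S (p + h *: v)].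
  have e2 : 0 < e / 2 by rewrite divr_gt0.
  have ee : `|e / 2| < e.
    by rewrite gtr0_norm // ltr_pdivrMr // ltr_pMr // ltr1n.
  have [v0|v0] : 0 <= e / 2 * v.1 \/ 0 <= - (e / 2) * v.1.
  - case: (leP 0 (e / 2 * v.1)) => [|/ltW]; first by left.
    by right; rewrite mulNr oppr_ge0.
  - exists (if left then - (e / 2) else e / 2).
    move: Sp; rewrite /worldsheet; case: left => /= Sp; split;
      rewrite ?normrN ?oppr_eq0 ?gt_eqF //.
    + by rewrite /GRing.scale /= mulNr subr_le0 (le_trans Sp).
    + by rewrite /GRing.scale /= addr_ge0.
  - exists (if left then e / 2 else - (e / 2)).
    move: Sp; rewrite /worldsheet; case: left => /= Sp; split;
      rewrite ?normrN ?oppr_eq0 ?gt_eqF //.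
    + rewrite /GRing.scale /=; move: v0; rewrite mulNr oppr_ge0 => v0.
      by rewrite -[leRHS]addr0 lerD.
    + by rewrite /GRing.scale /= addr_ge0.
by apply: (eP h) => //=; rewrite sub0r normrN.
Qed.

Lemma deriv_inE (V : normedModType R) (f : R * R -> V) p v (X : V) : S p ->
  has_quot (ray p v) (fun h => f (p + h *: v)) (f p) X -> deriv_in S f p v = X.
Proof.
move=> Sp; have := ray_proper v Sp => PF.
by apply: cvg_lim; exact: norm_hausdorff.
Qed.

Lemma log_derivE g p v X : S p ->
  log_vel (ray p v) (fun h => g (p + h *: v)) (g p) X ->
  log_deriv left g p v = X.
Proof.
move=> Sp gX; have PF := ray_proper v Sp; have F0 := @ray_dnbhs p v.
have [_ qX] := (log_velE PF F0 _ _ _).1 gX.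
rewrite /log_deriv /velocity (deriv_inE Sp qX).
exact: ltransK.
Qed.

Lemma has_quot_ray p v (V : normedModType R)
    (f : {linear (R * R)%type -> V}) : S p ->
  has_quot (ray p v) (fun h => f (p + h *: v)) (f p) (f v).
Proof.
move=> Sp; have PF := ray_proper v Sp; have F0 := @ray_dnbhs p v.
have := @has_quot_line _ _ PF F0 _ (f p) (f v) 1; rewrite scale1r.
by apply: has_quot_ext; apply: nearW => h; rewrite mul1r linearD linearZ.
Qed.

(** The same map [D] serves all directions, so the derivatives are linear in [v] although each is a
    limit along its own filter. *)
Lemma smooth_log_deriv g p : smooth_to S g -> S p ->
  (forall v, log_vel (ray p v) (fun h => g (p + h *: v)) (g p)
                     (log_deriv left g p v)) /\
  linear (log_deriv left g p).
Proof.
move=> sg Sp; have [D [_ _ Dv]] := smooth_at_velE (smooth_to_at sg Sp) Sp.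
have LD v : log_vel (ray p v) (fun h => g (p + h *: v)) (g p)
    (theta_L (g p) (D v)).
  have PF := ray_proper v Sp; have F0 := @ray_dnbhs p v.
  apply: (has_velE PF F0 _ _ _).1.
  apply: (Dv _ PF F0 (fun h => p + h *: v) v); first exact: ray_in.
  have H := @has_quot_ray p v (R * R)%type idfun Sp.
  exact: H.
have LE v : log_deriv left g p v = theta_L (g p) (D v).
  exact: (log_derivE Sp (LD v)).
split=> [v|a v w]; first by rewrite LE.
by rewrite !LE linearP /theta_L mdiffD mdiffZ.
Qed.

Lemma log_deriv_inv g p v : smooth_to S g -> S p ->
  log_deriv left (fun p' => (g p')^-1%g) p v =
  - Ad (g p) (log_deriv left g p v).
Proof.
move=> sg Sp; have [gv _] := smooth_log_deriv sg Sp.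
have PF := ray_proper v Sp; have F0 := @ray_dnbhs p v.
exact: (log_derivE Sp (log_vel_inv PF F0 (gv v))).
Qed.

Lemma smooth_to_loop_act (h : R -> G) g : smooth_to setT h -> smooth_to S g ->
  smooth_to S (loop_act h g).
Proof.
move=> sh sg; apply: smooth_at_to => p Sp.
have oT := @openT (R * R)%type.
have l1 k : Ck_on k setT (fst : R * R -> R).
  by apply: (@Ck_on_lin _ _ _ _ setT fst) => x; exact: cvg_fst.
have l2 k : Ck_on k setT (snd : R * R -> R).
  by apply: (@Ck_on_lin _ _ _ _ setT snd) => x; exact: cvg_snd.
apply: smooth_at_mul; first (apply: smooth_at_mul; last exact: smooth_to_at).
  apply: (@smooth_at_comp _ _ _ _ _ setT S h (fun p => p.2 + p.1) setT) => //.
    by move=> k; apply: Ck_onD.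
  exact: smooth_to_at.
apply: smooth_at_inv.
apply: (@smooth_at_comp _ _ _ _ _ setT S h (fun p => p.2 - p.1) setT) => //.
  by move=> k; apply: Ck_onD => //; exact: Ck_onN.
exact: smooth_to_at.
Qed.

(** [v.2 + v.1] and [v.2 - v.1] are the derivatives of sigma^+ and sigma^- along [v], i.e. the
    speeds at which the two factors run through [h]. *)
Lemma log_deriv_loop_act (h : R -> G) g p v :
  smooth_to setT h -> smooth_to S g -> S p ->
  log_deriv left (loop_act h g) p v =
  Ad (h (p.2 - p.1))
   (Ad (g p)^-1%g ((v.2 + v.1) *: loop_log_deriv h (p.2 + p.1))
    + log_deriv left g p v - (v.2 - v.1) *: loop_log_deriv h (p.2 - p.1)).
Proof.
move=> sh sg Sp; have [gv _] := smooth_log_deriv sg Sp.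
have PF := ray_proper v Sp; have F0 := @ray_dnbhs p v.
apply: (log_derivE Sp); apply: (log_vel_conj PF F0 _ (gv v)).
  apply: (loop_log_vel PF F0 sh).
  have := @has_quot_line _ _ PF F0 _ (p.2 + p.1) (v.2 + v.1) 1; rewrite scale1r.
  apply: has_quot_ext; apply: nearW => r.
  by rewrite /GRing.scale /= mul1r mulrDr addrACA.
apply: (loop_log_vel PF F0 sh).
have := @has_quot_line _ _ PF F0 _ (p.2 - p.1) (v.2 - v.1) 1; rewrite scale1r.
apply: has_quot_ext; apply: nearW => r.
by rewrite /GRing.scale /= mul1r mulrBr opprD addrACA.
Qed.

End Worldsheet.

(** * Gluing conditions and currents *)

(* A non-convergent filter has a junk limit, which is the same on both sides
   because Ad_x is invertible. *)
Lemma lim_Ad0 (R : realType) (n : nat) (G : lieGroupType R n) (T : Type)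
    (F : set_system T) (FF : ProperFilter F) (x : G) (f : T -> 'rV[R]_n) :
  lim (f @ F) = 0 -> lim ((fun a => Ad x (f a)) @ F) = 0.
Proof.
have Ad_cvg (y : G) (u : T -> 'rV[R]_n) l :
    u @ F --> l -> (fun a => Ad y (u a)) @ F --> Ad y l.
  by move=> ul; apply: (cvg_comp _ _ ul); exact: Ad_continuous.
have Ad0 (y : G) : Ad y 0 = 0 :> 'rV[R]_n
  by have := AdB y 0 0; rewrite !subrr.
have [/cvg_ex[l fl] f0|Nf f0] := pselect (cvg (f @ F)).
  rewrite (cvg_lim (@norm_hausdorff _ _) fl) in f0.
  have := Ad_cvg x _ _ fl; rewrite f0 Ad0 => fx.
  exact: (cvg_lim (@norm_hausdorff _ _) fx).
have NA : ~ cvg ((fun a => Ad x (f a)) @ F).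
  move=> /cvg_ex[l fl]; apply: Nf; apply/cvg_ex.
  exists (Ad x^-1%g l); have := Ad_cvg x^-1%g _ _ fl.
  by under eq_cvg do rewrite AdK.
by rewrite (dvgP NA) -(dvgP Nf).
Qed.

Section Branes.
Variables (R : realType) (n : nat) (G : lieGroupType R n).
Variables (tr : 'rV[R]_n -> 'rV[R]_n -> R) (t : 'M[R]_n) (k : nat).
Hypotheses (tr_form : trace_form G tr t) (k_gt0 : (0 < k)%N).
Variable left : bool.
Implicit Types (q : G) (X Y Z U V W : 'rV[R]_n) (g : R * R -> G) (s : R).

Local Notation S := (@worldsheet R left).

Let kR0 : (k%:R : R) != 0. Proof. by rewrite pnatr_eq0 -lt0n. Qed.
Let pi0 : (pi : R) != 0. Proof. by rewrite gt_eqF // pi_gt0. Qed.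

Lemma worldsheet_boundary s : S (0, s).
Proof. by rewrite /worldsheet /=; case: left. Qed.

Lemma tangent_class_theta q V :
  tangent_class q V <-> exists U, theta_L q V = U - Ad q U.
Proof.
rewrite tangent_classP; split=> -[Z ->].
  by exists (Ad q^-1%g Z); rewrite AdVK.
by exists (Ad q Z); rewrite AdK.
Qed.

Lemma metric_standardP q U V W :
  - metric tr k q V U = standard_curvature tr k q V W <->
  2 * tr (theta_L q V) (theta_L q U) =
  tr (theta_L q V) (cayley_Ad q (theta_L q W))
  - tr (theta_L q W) (cayley_Ad q (theta_L q V)).
Proof.
rewrite /metric /standard_curvature; set x := tr _ (theta_L q U).
set y := (_ - _); have c0 : k%:R / (8 * pi) != 0 :> R.
  by rewrite mulf_neq0 // invr_neq0 // mulf_neq0 // pnatr_eq0.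
have -> : - (- (k%:R / (4 * pi)) * x) = k%:R / (8 * pi) * (2 * x).
  by move: (@pi R) pi0 => P P0; field.
by split=> [/(mulfI c0)|->].
Qed.

(** Since g d_+ g^-1 = - Ad_g (g^-1 d_+ g), the difference of the currents is k / (4 pi) times A2 -
    A1 + Ad_g (A2 + A1). *)
Lemma currents_glueP g s : smooth_to S g -> let p := (0, s) in
  J_R k left g p - J_L k left g p = 0 <->
  log_deriv left g p (d1 R) - Ad (g p) (log_deriv left g p (d1 R)) =
  log_deriv left g p (d2 R) + Ad (g p) (log_deriv left g p (d2 R)).
Proof.
move=> sg p; have Sp := worldsheet_boundary s.
have [_ lin] := smooth_log_deriv sg Sp; rewrite -/p in lin.
rewrite /J_R /J_L log_deriv_inv // -/p.
set L := log_deriv left g p in lin *; set q := g p.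
have L0 : L 0 = 0.
  by have := lin (-1) 0 0; rewrite scaler0 addr0 scaleN1r addNr.
have Lp : L (dplus R) = 2^-1 *: (L (d2 R) + L (d1 R)).
  by rewrite /dplus -[_ *: _]addr0 lin L0 addr0 -[d2 R]scale1r lin !scale1r.
have Lm : L (dminus R) = 2^-1 *: (L (d2 R) - L (d1 R)).
  rewrite /dminus -[_ *: _]addr0 lin L0 addr0 [d2 R - _]addrC -scaleN1r lin.
  by rewrite scaleN1r addrC.
rewrite Lp Lm AdZ AdD scalerN opprK -scalerDr -scalerDr scalerA.
set c := _ / _ * 2^-1; have c0 : c != 0.
  by rewrite /c !mulf_neq0 // invr_neq0 // ?mulf_neq0 // pnatr_eq0.
have -> :
    (c *: (L (d2 R) - L (d1 R) + (Ad q (L (d2 R)) + Ad q (L (d1 R)))) = 0) <->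
    L (d2 R) - L (d1 R) + (Ad q (L (d2 R)) + Ad q (L (d1 R))) = 0.
  split=> [/eqP|->]; last by rewrite scaler0.
  by rewrite scaler_eq0 (negbTE c0) => /eqP.
move: (L (d1 R)) (L (d2 R)) (Ad q (L (d1 R))) (Ad q (L (d2 R))) => a b a' b'.
split=> /eqP E; apply/eqP; move: E; rewrite -subr_eq0 => /eqP E.
  rewrite -subr_eq0 -oppr_eq0 -{}[X in _ == X]E; apply/eqP.
  by apply/rowP => i; rewrite !mxE; ring.
rewrite -oppr_eq0 -{}[X in _ == X]E; apply/eqP.
by apply/rowP => i; rewrite !mxE; ring.
Qed.

Section Gluing.
Variable om : G -> 'rV[R]_n -> 'rV[R]_n -> R.

Definition gluing_at g s : Prop := let p := (0, s) in
  tangent_class (g p) (velocity S g p (d2 R)) /\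
  forall V, tangent_class (g p) V ->
    - metric tr k (g p) V (velocity S g p (d1 R))
    = om (g p) V (velocity S g p (d2 R)).

Lemma standard_gluingP g s : smooth_to S g ->
  (forall V W, tangent_class (g (0, s)) V -> tangent_class (g (0, s)) W ->
     om (g (0, s)) V W = standard_curvature tr k (g (0, s)) V W) ->
  gluing_at g s <->
  (exists Y, log_deriv left g (0, s) (d2 R) = Y - Ad (g (0, s)) Y) /\
  J_R k left g (0, s) - J_L k left g (0, s) = 0.
Proof.
move=> sg omE; rewrite currents_glueP // /gluing_at /=.
set q := g (0, s) in omE *.
split=> [[tW glue]|[[Y A2Y] curr]].
  have /tangent_class_theta[Y A2Y] := tW; split; first by exists Y.
  apply: ((standard_pairing tr_form _ A2Y).2 _) => X U XU.
  have XE : theta_L q (ltrans q X) = X by exact: ltransK.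
  have tX : tangent_class q (ltrans q X).
    by apply/tangent_class_theta; exists U; rewrite XE.
  have := glue _ tX; rewrite omE // => /metric_standardP.
  by rewrite XE.
have tW : tangent_class q (velocity S g (0, s) (d2 R)).
  by apply/tangent_class_theta; exists Y.
split=> // V tV; rewrite omE //; apply/metric_standardP.
have /tangent_class_theta[U VU] := tV.
exact: ((standard_pairing tr_form _ A2Y).1 curr _ U VU).
Qed.

End Gluing.

End Branes.

(** * Loop group symmetry *)

(** [x] and [H] are the value and the logarithmic derivative of the loop. Up to the overall [Ad x],
    the action adds [Ad q^-1 H + H] to [A1] and [Ad q^-1 H - H] to [A2]; id - Ad q and id + Ad q
    respectively send these to the same vector, [Ad q^-1 H - Ad q H]. *)
Lemma conj_gluing (R : realType) (n : nat) (G : lieGroupType R n) (x q : G)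
    (H A1 A2 Y : 'rV[R]_n) :
  A2 = Y - Ad q Y -> A1 - Ad q A1 = A2 + Ad q A2 ->
  let q' := (x * q * x^-1)%g in
  let B1 := Ad x (Ad q^-1%g H + A1 + H) in
  let B2 := Ad x (Ad q^-1%g H + A2 - H) in
  (exists Y', B2 = Y' - Ad q' Y') /\ B1 - Ad q' B1 = B2 + Ad q' B2.
Proof.
move=> A2Y curr q' B1 B2.
have AE v : Ad q' (Ad x v) = Ad x (Ad q v) by rewrite /q' AdM AdM AdK.
split.
  (* The added term [Ad q^-1 H - H] is the image of [Ad q^-1 H] under id - Ad q. *)
  exists (Ad x (Ad q^-1%g H + Y)).
  rewrite AE -AdB /B2 A2Y; congr Ad; rewrite AdD AdVK.
  move: (Ad q^-1%g H) (Ad q Y) => a b.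
  by apply/rowP => i; rewrite !mxE; ring.
rewrite /B1 /B2 !AE -AdB -AdD; congr Ad.
rewrite !(AdB, AdD) AdVK.
move: curr; move: (Ad q^-1%g H) (Ad q A1) (Ad q A2) (Ad q H) => a b c d.
move=> /rowP curr; apply/rowP => i; have := curr i; rewrite !mxE => E.
by lra.
Qed.

Section LoopSymmetry.
Variables (R : realType) (n : nat) (G : lieGroupType R n).
Variables (tr : 'rV[R]_n -> 'rV[R]_n -> R) (t : 'M[R]_n) (k : nat).
Hypotheses (tr_form : trace_form G tr t) (k_gt0 : (0 < k)%N).
Variable left : bool.
Variables (Q : set G) (om : G -> 'rV[R]_n -> 'rV[R]_n -> R).
Implicit Types (q : G) (X Y Z U V W : 'rV[R]_n) (g : R * R -> G) (s : R).

Local Notation S := (@worldsheet R left).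

Lemma log_deriv_loop_act_boundary (h : R -> G) g s (v : R * R) :
  smooth_to setT h -> smooth_to S g ->
  log_deriv left (loop_act h g) (0, s) v =
  Ad (h s) (Ad (g (0, s))^-1%g ((v.2 + v.1) *: loop_log_deriv h s)
    + log_deriv left g (0, s) v - (v.2 - v.1) *: loop_log_deriv h s).
Proof.
move=> sh sg.
rewrite (log_deriv_loop_act v sh sg (worldsheet_boundary left s)).
have -> : (0, s).2 + (0, s).1 = s := addr0 s.
have -> : (0, s).2 - (0, s).1 = s := subr0 s.
exact: erefl.
Qed.

Lemma loop_act_boundary (h : R -> G) g s :
  loop_act h g (0, s) = (h s * g (0, s) * (h s)^-1)%g.
Proof. by rewrite /loop_act /= addr0 subr0. Qed.

Section Standard.
Hypothesis Q_conj : forall x q, Q q -> Q (x * q * x^-1)%g.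
Hypothesis om_standard : forall q, Q q -> forall V W, tangent_class q V ->
  tangent_class q W -> om q V W = standard_curvature tr k q V W.

Lemma fields_currents g s : fields tr k Q om left g ->
  (exists Y, log_deriv left g (0, s) (d2 R) = Y - Ad (g (0, s)) Y) /\
  J_R k left g (0, s) - J_L k left g (0, s) = 0.
Proof.
move=> [sg _ Qg glue].
apply: ((standard_gluingP tr_form k_gt0 sg _).1 (glue s)).
by move=> V W; exact: om_standard.
Qed.

Lemma fields_loop_act (h : R -> G) g : loop_group h ->
  fields tr k Q om left g -> fields tr k Q om left (loop_act h g).
Proof.
move=> [sh ph] fg; have [sg pg Qg glue] := fg.
have sg' := smooth_to_loop_act sh sg.
have Qg' s : Q (loop_act h g (0, s)).
  by rewrite loop_act_boundary; exact: Q_conj.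
split; [exact: sg'|move=> p Sp|exact: Qg'|move=> s].
  by rewrite /loop_act (pg p Sp) (addrAC p.2) ph (addrAC p.2) ph.
apply: ((standard_gluingP tr_form k_gt0 sg' (om_standard (Qg' s))).2).
have [[Y A2Y] /(currents_glueP k_gt0 s sg) curr] := fields_currents s fg.
have E1 : log_deriv left (loop_act h g) (0, s) (d1 R) = _ :=
  log_deriv_loop_act_boundary s (d1 R) sh sg.
have E2 : log_deriv left (loop_act h g) (0, s) (d2 R) = _ :=
  log_deriv_loop_act_boundary s (d2 R) sh sg.
(* d_1 moves sigma^+ and sigma^- in opposite senses, d_2 in the same sense: hence the two signs of
   [H] in [conj_gluing]. *)
have d1p : (d1 R).2 + (d1 R).1 = 1 := add0r 1.
have d1m : (d1 R).2 - (d1 R).1 = - 1 := add0r (- 1).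
have d2p : (d2 R).2 + (d2 R).1 = 1 := addr0 1.
have d2m : (d2 R).2 - (d2 R).1 = 1 := subr0 1.
rewrite d1p d1m scaleN1r scale1r opprK in E1.
rewrite d2p d2m scale1r in E2.
have [A2Y' curr'] := conj_gluing (h s) (loop_log_deriv h s) A2Y curr.
split; first by rewrite E2 loop_act_boundary; exact: A2Y'.
apply: (currents_glueP k_gt0 s sg').2; rewrite E1 E2 loop_act_boundary.
exact: curr'.
Qed.

(** As sigma^+ is constant along d_-, the action turns g^-1 d_- g into its image under Ad of h^-,
    after subtracting the logarithmic derivative of h^-. Both h^- and that shift are constant along
    d_+, so the shift cancels in difference quotients and Ad factors out. *)
Lemma fields_eom_loop_act (h : R -> G) g : loop_group h ->
  fields_eom tr k Q om left g -> fields_eom tr k Q om left (loop_act h g).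
Proof.
move=> lh [fg eom]; split; first exact: fields_loop_act.
have [sh _] := lh; have [sg _ _ _] := fg.
move=> p Sp; have := eom p Sp; rewrite /deriv_in.
have PF := ray_proper (dplus R) Sp; rewrite -/(ray left p (dplus R)).
move=> /(lim_Ad0 PF (h (p.2 - p.1))) <-; congr (lim _).
have LE p' : S p' -> log_deriv left (loop_act h g) p' (dminus R) =
    Ad (h (p'.2 - p'.1)) (log_deriv left g p' (dminus R)
                          - loop_log_deriv h (p'.2 - p'.1)).
  move=> Sp'; rewrite log_deriv_loop_act //.
  have -> : (dminus R).2 + (dminus R).1 = 0.
    by rewrite /dminus /d1 /d2 /= /GRing.scale /=; field.
  have -> : (dminus R).2 - (dminus R).1 = 1.
    by rewrite /dminus /d1 /d2 /= /GRing.scale /=; field.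
  rewrite scale0r scale1r; congr (Ad _ (_ - _)).
  by have := AdB (g p')^-1%g 0 0; rewrite !subrr => ->; rewrite add0r.
have E : \forall a \near ray left p (dplus R),
    a^-1 *: (log_deriv left (loop_act h g) (p + a *: dplus R) (dminus R)
             - log_deriv left (loop_act h g) p (dminus R)) =
    Ad (h (p.2 - p.1)) (a^-1 *: (log_deriv left g (p + a *: dplus R) (dminus R)
                                 - log_deriv left g p (dminus R))).
  have := @ray_in R left p (dplus R); apply: filterS => a Sa.
  have pa : (p + a *: dplus R).2 - (p + a *: dplus R).1 = p.2 - p.1.
    by rewrite /dplus /d1 /d2 /= /GRing.scale /=; field.
  rewrite (LE _ Sa) (LE _ Sp) pa -AdB AdZ; congr (_ *: Ad _ _).
  by rewrite opprB addrA subrK.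
(* The image filters themselves are equal, so the two values of [lim] agree even without
   convergence. *)
apply/seteqP; split; apply: near_eq_cvg; first exact: E.
by move: E; apply: filterS => a Ea; exact: esym Ea.
Qed.

End Standard.

(** * Recovering the curvature from the symmetries *)

Section Converse.
Hypothesis om_linear : forall q, Q q -> forall a V V' W, tangent_class q V ->
  tangent_class q V' -> tangent_class q W ->
  om q (a *: V + V') W = a * om q V W + om q V' W.

Lemma theta_orbit_mx q Z :
  theta_L q (orbit_diff q Z) = Z *m (Ad_mx q^-1%g - 1%:M).
Proof. by rewrite theta_orbit_diff mulmxBr mul_Ad_mx mulmx1. Qed.

(* [two_form] makes [om] linear in its first argument only, so [om q V 0] need
   not vanish and a field constant along the boundary may have a nonzero normal
   derivative, here [D]. *)
Lemma normal_log_deriv q : Q q -> exists D, forall V, tangent_class q V ->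
  k%:R / (4 * pi) * tr (theta_L q V) D = om q V 0.
Proof.
move=> Qq; pose M := Ad_mx q^-1%g - 1%:M.
have tO Z : tangent_class q (orbit_diff q Z) by exists Z.
have t0 : tangent_class q (0 : 'rV[R]_n).
  exists 0 => //; have := mdiffZ (fun x : G => (x * q * x^-1)%g) 1%g 0 0.
  by rewrite !scale0r.
(* [pinvmx M] extends [om q V 0], as a function of [theta_L q V], from the tangent space to the
   whole Lie algebra, as [tr_represent] requires; 4 pi / k cancels the constant of the metric. *)
pose l X : R := (4 * pi / k%:R) * om q (orbit_diff q (X *m pinvmx M)) 0.
have ll : scalar l.
  move=> a X Y; rewrite /l mulmxDl -scalemxAl.
  rewrite /orbit_diff mdiffD mdiffZ om_linear //; [|exact: tO|exact: tO].
  by rewrite mulrDr mulrCA.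
pose l' : {scalar 'rV[R]_n} :=
  HB.pack l (GRing.isLinear.Build R 'rV[R]_n R *%R l ll).
have [D DE] := tr_represent tr_form l'; exists D => _ [Z _ <-].
rewrite -/(orbit_diff q Z) DE /= /l.
have -> : orbit_diff q (theta_L q (orbit_diff q Z) *m pinvmx M) =
    orbit_diff q Z.
  apply: (can_inj (theta_LK q)); rewrite !theta_orbit_mx -/M mulmxKpV //.
  exact: submxMl.
have k0 : (k%:R : R) != 0 by rewrite pnatr_eq0 -lt0n.
have P0 : (pi : R) != 0 by rewrite gt_eqF // pi_gt0.
by move: (@pi R) P0 => P P0; field; rewrite k0 P0.
Qed.

Lemma exists_boundary_static_field q : Q q ->
  exists g, [/\ fields tr k Q om left g, g (0, 0) = q &
    log_deriv left g (0, 0) (d2 R) = 0].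
Proof.
move=> Qq; have [D DE] := normal_log_deriv Qq.
have [b [[sb pb] b0 bD]] := @exists_loop R n G D.
(* The loop [b] serves as a smooth curve in sigma^1 that starts at 1 with derivative [D], the value
   prescribed by the gluing condition. *)
pose g (p : R * R) : G := (q * b p.1)%g; exists g.
have gq s : g (0, s) = q by rewrite /g /= b0 mulg1.
have sg : smooth_to S g.
  apply: smooth_at_to => p Sp; apply: smooth_at_mul; first exact: smooth_at_cst.
  apply: (@smooth_at_comp _ _ _ _ _ setT S b fst setT) => //.
  - exact: openT.
  - by move=> i; apply: (@Ck_on_lin _ _ _ _ setT fst) => x; exact: cvg_fst.
  - exact: smooth_to_at.
have gv s (v : R * R) : log_deriv left g (0, s) v = v.1 *: D.
  have Sp : S (0, s) := worldsheet_boundary left s.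
  have PF := ray_proper v Sp; have F0 := @ray_dnbhs R left (0, s) v.
  apply: (log_derivE Sp).
  have qv : has_quot (ray left (0, s) v) (fun h => 0 + h * v.1) (0 : R) v.1.
    have := @has_quot_line _ _ PF F0 _ (0 : R) v.1 1; rewrite scale1r.
    by apply: has_quot_ext; apply: nearW => a; rewrite mul1r.
  have bv := loop_log_vel PF F0 sb qv.
  rewrite bD in bv.
  have := log_vel_mul PF F0 (log_vel_cst PF q) bv.
  by have := AdB (b 0)^-1%g 0 0; rewrite !subrr => ->; rewrite add0r.
split; [|exact: gq|by rewrite gv scale0r].
split; [exact: sg|by move=> p _|by move=> s; rewrite gq|move=> s].
have th0 (x : G) : theta_L x (0 : 'rV[R]_n) = 0 :> 'rV[R]_n.
  by have := mdiffZ (fun y : G => (x^-1 * y)%g) x 0 0; rewrite !scale0r.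
have v2 : velocity S g (0, s) (d2 R) = 0.
  apply: (can_inj (theta_LK (g (0, s)))); rewrite th0.
  by have := gv s (d2 R); rewrite scale0r.
have v1 : theta_L (g (0, s)) (velocity S g (0, s) (d1 R)) = D.
  by have := gv s (d1 R); rewrite scale1r.
rewrite /= v2 gq; split.
  apply/tangent_classP; exists 0; rewrite th0.
  by have := AdB q^-1%g 0 0; rewrite !subrr => ->; rewrite subr0.
rewrite gq in v1.
by move=> V tV; rewrite -(DE _ tV) /metric v1 mulNr opprK.
Qed.

Lemma loop_symmetry_standard q V W :
  (forall h g, loop_group h -> fields tr k Q om left g ->
    fields tr k Q om left (loop_act h g)) ->
  currents_glue tr k Q om left ->
  Q q -> tangent_class q V -> tangent_class q W ->
  om q V W = standard_curvature tr k q V W.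
Proof.
move=> act glue Qq tV /tangent_classP[Z WZ].
have [g [fg gq gD2]] := exists_boundary_static_field Qq.
(* Because [h 0 = 1], the boundary point stays at [q], while the logarithmic derivative along the
   boundary moves from 0 to [Ad q^-1 Z - Z], which is [theta_L q W] by the choice of [Z]. *)
have [h [lh h0 hZ]] := @exists_loop R n G Z.
have fg' := act h g lh fg; have [sh _] := lh.
have [sg _ _ _] := fg; have [sg' _ _ gl] := fg'.
have gq' : loop_act h g (0, 0) = q.
  by rewrite loop_act_boundary h0 gq mul1g invg1 mulg1.
have := glue _ fg' 0; rewrite (currents_glueP k_gt0 0 sg') gq'.
have [_] := gl 0; rewrite gq'.
have E2 := log_deriv_loop_act_boundary 0 (d2 R) sh sg.
have d2p : (d2 R).2 + (d2 R).1 = 1 := addr0 1.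
have d2m : (d2 R).2 - (d2 R).1 = 1 := subr0 1.
rewrite gD2 gq h0 hZ Ad1 d2p d2m !scale1r addr0 -WZ in E2.
rewrite E2 => /(_ V tV).
have -> : velocity (worldsheet left) (loop_act h g) (0, 0) (d2 R) = W.
  by apply: (can_inj (theta_LK q)); rewrite -E2 /log_deriv gq'.
(* The gluing condition trades [om q V W] for the metric term, which the matching of currents
   evaluates by [standard_pairing]. *)
move=> <- curr; apply/metric_standardP => //.
have tW : tangent_class q W by apply/tangent_classP; exists Z.
have [Y WY] := (tangent_class_theta q W).1 tW.
have [U VU] := (tangent_class_theta q V).1 tV.
have := (standard_pairing tr_form _ WY).1 curr _ U VU.
by rewrite /log_deriv gq'.
Qed.

End Converse.
End LoopSymmetry.

Lemma brane_conj (R : realType) (n : nat) (G : lieGroupType R n)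
    (tr : 'rV[R]_n -> 'rV[R]_n -> R) (T : 'M[R]_n) (k r : nat)
    (S : 'M[R]_(r, n)) (theta : 'rV[R]_n) (x q : G) :
  brane G tr T k S theta q -> brane G tr T k S theta (x * q * x^-1)%g.
Proof.
move=> [L dL [q0 [y [eq0 ->]]]]; exists L => //; exists q0, (x * y)%g.
by split=> //; rewrite invgM !mulgA.
Qed.

Theorem proposition30 (R : realType) (n : nat) (G : lieGroupType R n)
  (G_compact : compact [set: G]) (G_simple : simple_lie_algebra G)
  (G_1connected : one_connected G)
  (tr : 'rV[R]_n -> 'rV[R]_n -> R) (t : 'M[R]_n) (tr_form : trace_form G tr t)
  (k : nat) (k_gt0 : (0 < k)%N)
  (T : 'M[R]_n) (T_cartan : cartan G T)
  (r : nat) (S : 'M[R]_(r, n)) (S_simple : simple_roots G tr T S)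
  (theta : 'rV[R]_n) (theta_highest : highest_root G tr T S theta)
  (om : G -> 'rV[R]_n -> 'rV[R]_n -> R)
  (om_curv : brane_curvature tr k (brane G tr T k S theta) om)
  (om_inv : Ad_invariant (brane G tr T k S theta) om)
  (left : bool) :
  let Q := brane G tr T k S theta in
  ([/\ loop_group_acts_on (fields tr k Q om left),
       loop_group_acts_on (fields_eom tr k Q om left) &
       currents_glue tr k Q om left]
   <->
   forall L, dominant_weights G tr T k S theta L ->
   forall q, conj_class G k L q ->
   forall V W, tangent_class q V -> tangent_class q W ->
     om q V W = standard_curvature tr k q V W).
Proof.
move=> Q; split=> [[[act _ _] _ glue] L dL q Lq V W tV tW|std].
  have [[om_lin _ _] _] := om_curv.
  apply: (loop_symmetry_standard tr_form k_gt0 om_lin act glue) => //.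
  by exists L.
have Qconj x q : Q q -> Q (x * q * x^-1)%g by exact: brane_conj.
have omE q : Q q -> forall V W, tangent_class q V -> tangent_class q W ->
    om q V W = standard_curvature tr k q V W.
  by move=> [L dL Lq]; exact: std dL _ Lq.
have act1 g : loop_act (fun=> 1%g) g = g.
  by apply/funext => p; rewrite /loop_act mul1g invg1 mulg1.
have actM h h' g : loop_act (fun s => (h s * h' s)%g) g =
    loop_act h (loop_act h' g) :> (R * R -> G).
  by apply/funext => p; rewrite /loop_act invgM !mulgA.
split.
- split=> [h g lh fg|g _|h h' g _ _ _]; [|exact: act1|exact: actM].
  exact: (fields_loop_act tr_form k_gt0 Qconj omE lh fg).
- split=> [h g lh fg|g _|h h' g _ _ _]; [|exact: act1|exact: actM].
  exact: (fields_eom_loop_act tr_form k_gt0 Qconj omE lh fg).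
- by move=> g fg s; exact: (fields_currents tr_form k_gt0 omE s fg).2.
Qed.
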